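(* Let $\mu \in \mathfrak{M}_{x}(\mathcal{U})$ be fim over a small model $M \prec \mathcal{U}$, $\nu \in \mathfrak{M}_{y}(\mathcal{U})$ arbitrary, $\varphi(x,y,z)$ an $\mathcal{L}$-formula, $b \in \mathcal{U}^{z}$, and $\mathbf{x} = (x_i)_{i \in \omega}$ (each $x_i$ of the same sort as $x$). Suppose that $\lambda \in \mathfrak{M}_{\mathbf{x}y}(\mathcal{U})$ is arbitrary such that $\lambda|_{\mathbf{x},M} = \mu^{(\omega)}|_M$ and $\lambda|_{y} = \nu$. Then $$\lim_{i \to \infty} \lambda(\varphi(x_i,y,b)) = \mu \otimes \nu(\varphi(x,y,b)).$$ Moreover, for every $\varepsilon > 0$ there exists $n = n(\mu, \varphi, \varepsilon) \in \mathbb{N}$ such that for any $\nu \in \mathfrak{M}_{y}(\mathcal{U})$, any $b \in \mathcal{U}^{z}$, and any $\lambda \in \mathfrak{M}_{\mathbf{x}y}(\mathcal{U})$ with $\lambda|_{\mathbf{x},M} = \mu^{(\omega)}|_M$ and $\lambda|_{y} = \nu$, we have $|\lambda(\varphi(x_i,y,b)) - \mu \otimes \nu(\varphi(x,y,b))| \leq \varepsilon$ for all but at most $n$ many $i \in \mathbb{N}$.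
   Context: $T$ is an arbitrary complete first-order theory, $\mathcal{U}$ a monster model, $\mathfrak{M}_x(\mathcal{U})$ the space of global Keisler measures in variable $x$. A Borel-definable $M$-invariant measure $\mu$ is fim (frequency interpretation measure) over $M$ if for every $\mathcal{L}$-formula $\varphi(x,y)$ there are $\mathcal{L}(M)$-formulas $\theta_n(x_1,\dots,x_n)$ with $\lim_n \mu^{(n)}(\theta_n)=1$ and such that for every $\varepsilon>0$ there is $n_\varepsilon$ so that for $k \geq n_\varepsilon$ and any $\bar a \models \theta_k$, $\sup_{b}|\operatorname{Av}(\bar a)(\varphi(x,b)) - \mu(\varphi(x,b))|<\varepsilon$. Here $\otimes$ is the Morley product, $\mu^{(n)}$ the iterated Morley power, and $\mu^{(\omega)} = \bigcup_n \mu^{(n)}$. *)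

(* Defs.v *)
From HB Require Import structures.
From mathcomp Require Import all_boot all_order all_algebra.
From mathcomp Require Import all_classical all_reals all_analysis.

Set Implicit Arguments.
Unset Strict Implicit.
Unset Printing Implicit Defensive.
Import Order.TTheory GRing.Theory Num.Theory.
Import numFieldNormedType.Exports.
Local Open Scope classical_set_scope.
Local Open Scope card_scope.
Local Open Scope ring_scope.

Record language := Language {
  lsort : Type;
  fsymb : Type;
  farity : fsymb -> nat;
  fdom : forall f, 'I_(farity f) -> lsort;
  fcod : fsymb -> lsort;
  rsymb : Type;
  rarity : rsymb -> nat;
  rdom : forall r, 'I_(rarity r) -> lsort }.

(* A tuple of variables is a type of variables, each with its sort. *)
Record ctx (L : language) := Ctx { var :> Type; srt : var -> lsort L }.
Arguments srt {L c}.

Definition finctx L (X : ctx L) : Prop := finite_set [set: X].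

Section contexts.
Context {L : language}.
Implicit Types X Y : ctx L.

Definition cnil : ctx L := Ctx (fun v : void => match v with end).

Definition csnoc X (t : lsort L) : ctx L :=
  Ctx (fun o : option X => if o is Some v then srt v else t).

Definition ccat X Y : ctx L :=
  Ctx (fun v : X + Y => match v with inl x => srt x | inr y => srt y end).

(* I-indexed family of disjoint copies of the tuple X; the variable (i, v) is
   the coordinate v of x_i. *)
Definition ccopies (I : Type) X : ctx L := Ctx (fun v : I * X => srt v.2).

Inductive lterm X : lsort L -> Type :=
| tvar (v : X) : lterm X (srt v)
| tapp (f : fsymb L) (a : forall i, lterm X (@fdom L f i)) : lterm X (fcod f).

Inductive formula X : Type :=
| ftrue
| feq (t : lsort L) (a b : lterm X t)
| fatom (r : rsymb L) (a : forall i, lterm X (@rdom L r i))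
| fnot (phi : formula X)
| fand (phi psi : formula X)
| fex (t : lsort L) (phi : formula (csnoc X t)).

Fixpoint tfv X t (a : lterm X t) : set X :=
  match a with
  | tvar v => [set v]
  | tapp f a => [set v | exists i, tfv (a i) v]
  end.

Fixpoint fv X (phi : formula X) : set X :=
  match phi with
  | ftrue => set0
  | feq t a b => tfv a `|` tfv b
  | fatom r a => [set v | exists i, tfv (a i) v]
  | fnot phi => fv phi
  | fand phi psi => fv phi `|` fv psi
  | fex t phi => [set v | fv phi (Some v)]
  end.

Definition substitution X Y := forall v : X, lterm Y (srt v).

Fixpoint tsubst X Y (s : substitution X Y) t (a : lterm X t) : lterm Y t :=
  match a with
  | tvar v => s v
  | tapp f a => tapp (fun i => tsubst s (a i))
  end.

Definition tweak X t : substitution X (csnoc X t) :=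
  fun v => @tvar (csnoc X t) (Some v).

Definition subst_up X Y t (s : substitution X Y) :
    substitution (csnoc X t) (csnoc Y t) :=
  fun o => match o as o return lterm (csnoc Y t) (@srt _ (csnoc X t) o) with
  | Some v => tsubst (@tweak Y t) (s v)
  | None => @tvar (csnoc Y t) None
  end.

Fixpoint fsubst X Y (s : substitution X Y) (phi : formula X) : formula Y :=
  match phi with
  | ftrue => ftrue Y
  | feq t a b => feq (tsubst s a) (tsubst s b)
  | fatom r a => fatom (fun i => tsubst s (a i))
  | fnot phi => fnot (fsubst s phi)
  | fand phi psi => fand (fsubst s phi) (fsubst s psi)
  | fex t phi => fex (fsubst (@subst_up X Y t s) phi)
  end.

End contexts.
Arguments ftrue {L X}.

Definition f_or L (X : ctx L) (phi psi : formula X) : formula X :=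
  fnot (fand (fnot phi) (fnot psi)).

Record structure (L : language) := Structure {
  car :> lsort L -> Type;
  car_nonempty : forall t, exists u : car t, True;
  ifun : forall f : fsymb L, (forall i, car (@fdom L f i)) -> car (fcod f);
  irel : forall r : rsymb L, (forall i, car (@rdom L r i)) -> Prop }.

(* The elements of N^X. *)
Definition assign L (N : structure L) (X : ctx L) := forall v : X, N (srt v).

Section semantics.
Context {L : language} (N : structure L).
Implicit Types X Y : ctx L.

Definition vsnoc X t (e : assign N X) (u : N t) : assign N (csnoc X t) :=
  fun o => match o as o return N (@srt _ (csnoc X t) o) with
  | Some v => e v
  | None => u
  end.

Definition vcat X Y (e : assign N X) (e' : assign N Y) : assign N (ccat X Y) :=
  fun v => match v as v return N (@srt _ (ccat X Y) v) with
  | inl x => e x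
  | inr y => e' y
  end.

Fixpoint teval X (e : assign N X) t (a : lterm X t) : N t :=
  match a with
  | tvar v => e v
  | tapp f a => @ifun L N f (fun i => teval e (a i))
  end.

Fixpoint sat X (phi : formula X) : assign N X -> Prop :=
  match phi with
  | ftrue => fun=> True
  | feq t a b => fun e => teval e a = teval e b
  | fatom r a => fun e => @irel L N r (fun i => teval e (a i))
  | fnot phi => fun e => ~ sat phi e
  | fand phi psi => fun e => sat phi e /\ sat psi e
  | fex t phi => fun e => exists u : N t, sat phi (vsnoc e u)
  end.

End semantics.

Definition theory L := set (formula (@cnil L)).

Definition models L (N : structure L) (T : theory L) : Prop :=
  forall s, T s -> forall e, sat (N := N) s e.

Definition complete_theory L (T : theory L) : Prop :=
  (exists N : structure L, models N T) /\
  forall s, (forall N : structure L, models N T -> models N [set s]) \/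
            (forall N : structure L, models N T -> models N [set fnot s]).

Definition ssubset L (N : structure L) := forall t, set (N t).

Section substructures.
Context {L : language} (N : structure L).

Definition tot (A : ssubset N) : set {t : lsort L & N t} :=
  [set a | A (projT1 a) (projT2 a)].

Definition nonempty_sorts (A : ssubset N) : Prop :=
  forall t, exists u, A t u.

Definition fun_closed (A : ssubset N) : Prop :=
  forall (f : fsymb L) (a : forall i, N (@fdom L f i)),
    (forall i, A _ (a i)) -> A _ (ifun a).

Lemma substructure_nonempty (A : ssubset N) : nonempty_sorts A ->
  forall t, exists _ : {u : N t | A t u}, True.
Proof. by move=> ne t; have [u Au] := ne t; exists (exist _ u Au). Qed.

Definition substructure (A : ssubset N) (ne : nonempty_sorts A)
    (cl : fun_closed A) : structure L :=
  @Structure L (fun t => {u : N t | A t u}) (substructure_nonempty ne)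
    (fun f a => exist (A (fcod f)) (ifun (fun i => sval (a i)))
                      (cl f _ (fun i => svalP (a i))))
    (fun r a => irel (fun i => sval (a i))).

Definition elementary_substructure (A : ssubset N) : Prop :=
  exists (ne : nonempty_sorts A) (cl : fun_closed A),
    forall (X : ctx L) (phi : formula X) (e : assign (substructure ne cl) X),
      sat phi e <-> sat (N := N) phi (fun v => sval (e v)).

(* Formulas with parameters in N: every element of N is an extra variable,
   always interpreted by itself. *)
Definition params : ctx L := Ctx (fun a : {t : lsort L & N t} => projT1 a).
Definition pform (X : ctx L) := formula (ccat X params).

Implicit Types X Y Z : ctx L.

Definition psat X (phi : pform X) (e : assign N X) : Prop :=
  sat (N := N) phi (vcat e (fun a : params => projT2 a)).

Definition pequiv X (phi psi : pform X) : Prop :=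
  forall e : assign N X, psat phi e <-> psat psi e.

(* [fml_over A phi]: phi is an L(A)-formula. *)
Definition params_of X (phi : pform X) : ssubset N :=
  fun t => [set u | fv phi (inr (existT N t u))].
Arguments params_of {X} phi t _.
Definition fml_over (A : ssubset N) X : set (pform X) :=
  [set phi | forall t, params_of phi t `<=` A t].

(* An L-formula as an L(N)-formula. *)
Definition plift X (phi : formula X) : pform X :=
  fsubst (fun v => @tvar L (ccat X params) (inl v)) phi.

(* phi(s(v))_{v in X}, parameters unchanged *)
Definition psubst X Y (s : substitution X Y) (phi : pform X) : pform Y :=
  fsubst (fun w : ccat X params =>
    match w as w return lterm (ccat Y params) (@srt _ (ccat X params) w) with
    | inl v => tsubst (fun y => @tvar L (ccat Y params) (inl y)) (s v)
    | inr a => @tvar L (ccat Y params) (inr a)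
    end) phi.

Definition pinst X Y (phi : pform (ccat X Y)) (c : assign N Y) : pform X :=
  fsubst (fun w : ccat (ccat X Y) params =>
    match w as w
      return lterm (ccat X params) (@srt _ (ccat (ccat X Y) params) w) with
    | inl (inl x) => @tvar L (ccat X params) (inl x)
    | inl (inr y) =>
        @tvar L (ccat X params) (inr (existT N (srt y) (c y)))
    | inr a => @tvar L (ccat X params) (inr a)
    end) phi.

End substructures.
Arguments fml_over {L N} A X.
Arguments params_of {L N X} phi t.

Section types.
Context {L : language} (U : structure L).
Implicit Types X Y : ctx L.

(* Complete types over A: maximal sets of L(A)-formulas that are finitely
   satisfiable in U. *)
Definition complete_type X (A : ssubset U) (p : set (pform U X)) : Prop :=
  [/\ p `<=` fml_over A X,
      forall phi, fml_over A X phi -> p phi \/ p (fnot phi) &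
      forall B, finite_set B -> B `<=` p ->
        exists e : assign U X, forall phi, B phi -> psat phi e].

Record stone X (A : ssubset U) :=
  Stone { tset : set (pform U X); tsetP : complete_type A tset }.

Definition realizes X A (e : assign U X) (q : stone X A) : Prop :=
  forall phi, tset q phi -> psat phi e.

Definition tp_set X (A : ssubset U) (e : assign U X) : set (pform U X) :=
  [set phi | fml_over A X phi /\ psat phi e].

Lemma tp_setP X A (e : assign U X) : complete_type A (tp_set A e).
Proof.
split=> [phi [] //|phi phiA|B _ BA]; last first.
  by exists e => phi /BA[].
by have [?|?] := pselect (psat phi e); [left|right]; split.
Qed.

Definition tp X A (e : assign U X) : stone X A := Stone (tp_setP A e).

Definition some_val X : assign U X :=
  fun v => projT1 (cid (car_nonempty U (srt v))).

Definition clopen_of X A (phi : pform U X) : set (stone X A) :=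
  [set q | tset q phi].

HB.instance Definition _ X A := gen_eqMixin (stone X A).
HB.instance Definition _ X A := gen_choiceMixin (stone X A).
HB.instance Definition _ X A :=
  isPointed.Build (stone X A) (tp A (@some_val X)).
HB.instance Definition _ X A := isSubBaseTopological.Build (stone X A)
  ((fun phi => @clopen_of X A phi) @` fml_over A X) id.

Definition borel_stone X A := g_sigma_algebraType (@open (stone X A)).

End types.
Arguments stone {L} U X A.
Arguments borel_stone {L} U X A.
Arguments clopen_of {L U X A} phi.

Section monster.
Context {L : language}.

Definition partial_elementary (U : structure L) (A : ssubset U)
    (f : forall t, U t -> U t) : Prop :=
  forall (X : ctx L) (phi : formula X) (e : assign U X),
    (forall v, A _ (e v)) ->
    sat phi e <-> sat (N := U) phi (fun v => f _ (e v)).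

Definition model_automorphism (U : structure L)
    (g : forall t, U t -> U t) : Prop :=
  [/\ forall t, bijective (g t),
      forall (f : fsymb L) a, g _ (@ifun L U f a) = ifun (fun i => g _ (a i)) &
      forall (r : rsymb L) a,
        @irel L U r a <-> irel (fun i => g _ (a i))].

(* The cardinal kappa is represented by a type K of that cardinality;
   ~~ (A #<= B) says |B| < |A|. *)
Definition small (K : Type) (U : structure L) (A : ssubset U) : Prop :=
  ~~ ([set: K] #<= tot A).

(* U is kappa-saturated and strongly kappa-homogeneous for some
   kappa > |L| + aleph_0. *)
Definition monster (K : Type) (U : structure L) : Prop :=
  [/\ [/\ ~~ ([set: K] #<= [set: nat]), ~~ ([set: K] #<= [set: lsort L]),
          ~~ ([set: K] #<= [set: fsymb L]) &
          ~~ ([set: K] #<= [set: rsymb L])],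
      forall (X : ctx L) (A : ssubset U), finctx X -> small K A ->
        forall q : stone U X A, exists e : assign U X, realizes e q &
      forall (A : ssubset U) (f : forall t, U t -> U t),
        small K A -> partial_elementary A f ->
        exists2 g, model_automorphism g & forall t u, A t u -> g t u = f t u].

End monster.

Section keisler.
Context {R : realType} {L : language} (U : structure L).
Implicit Types X Y Z : ctx L.

(* mu is a finitely additive probability measure on L_X(U)-formulas modulo
   equivalence, i.e. on the U-definable subsets of U^X. *)
Definition keisler X (mu : pform U X -> R) : Prop :=
  [/\ forall phi psi, pequiv phi psi -> mu phi = mu psi,
      forall phi, 0 <= mu phi,
      mu ftrue = 1 &
      forall phi psi, (forall e : assign U X, ~ (psat phi e /\ psat psi e)) ->
        mu (f_or phi psi) = mu phi + mu psi].

Definition inv_measure (M : ssubset U) X (mu : pform U X -> R) : Prop :=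
  forall Y (phi : formula (ccat X Y)) (b b' : assign U Y),
    finctx Y -> tp M b = tp M b' ->
    mu (pinst (plift U phi) b) = mu (pinst (plift U phi) b').

(* F(q) = mu(phi(x, c)) for any realization c of q. *)
Definition fiber X Y (A : ssubset U) (mu : pform U X -> R)
    (phi : pform U (ccat X Y)) (q : stone U Y A) : R :=
  xget 0 [set r | exists2 c : assign U Y, realizes c q & r = mu (pinst phi c)].

Definition borel_definable (M : ssubset U) X (mu : pform U X -> R) : Prop :=
  inv_measure M mu /\
  forall Y (phi : formula (ccat X Y)), finctx Y ->
    measurable_fun setT
      (fun q : borel_stone U Y M => fiber mu (plift U phi) (q : stone U Y M)).

(* P is the regular Borel probability measure on S_Y(A) that agrees with the
   restriction of nu to L_Y(A)-formulas. *)
Definition regular_extension Y (A : ssubset U) (nu : pform U Y -> R)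
    (P : probability (borel_stone U Y A) R) : Prop :=
  (forall phi, fml_over A Y phi -> P (clopen_of phi) = (nu phi)%:E) /\
  forall (B : set (borel_stone U Y A)) (eps : R), measurable B -> 0 < eps ->
    exists C O : set (stone U Y A),
      [/\ closed C, open O, C `<=` B, B `<=` O & (P (O `\` C) < eps%:E)%E].

(* The Morley product of an M-invariant Borel-definable mu with nu: the
   integral of q |-> mu(psi(x, q)) over S_Y(A), where A is M together with
   the parameters of psi. *)
Definition morley (M : ssubset U) X Y (mu : pform U X -> R)
    (nu : pform U Y -> R) (psi : pform U (ccat X Y)) : R :=
  let A : ssubset U := fun t => M t `|` params_of psi t in
  xget 0 [set r | exists2 P : probability (borel_stone U Y A) R,
    regular_extension nu P &
    r%:E = (\int[P]_q (fiber mu psi (q : stone U Y A))%:E)%E].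

(* x_n becomes the left block, (x_0, ..., x_{n-1}) the right block. *)
Definition split_last n X :
    substitution (ccopies 'I_n.+1 X) (ccat X (ccopies 'I_n X)) :=
  fun v => match unlift ord_max v.1 as o
             return lterm (ccat X (ccopies 'I_n X)) (srt v.2) with
  | Some j => @tvar L (ccat X (ccopies 'I_n X)) (inr (j, v.2))
  | None => @tvar L (ccat X (ccopies 'I_n X)) (inl v.2)
  end.

(* mu^(n+1)(x_0, ..., x_n) = mu(x_n) (x) mu^(n)(x_0, ..., x_{n-1}); mu^(0) is
   the unique measure in no variables, so that mu^(1) = mu. *)
Fixpoint morley_power (M : ssubset U) X (mu : pform U X -> R) (n : nat) :
    pform U (ccopies 'I_n X) -> R :=
  match n with
  | 0 => fun phi => `[< forall e : assign U (ccopies 'I_0 X), psat phi e >]%:R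
  | n.+1 => fun phi =>
      morley M mu (@morley_power M X mu n) (psubst (@split_last n X) phi)
  end.

Definition widen_copies n X : substitution (ccopies 'I_n X) (ccopies nat X) :=
  fun v => @tvar L (ccopies nat X) (val v.1, v.2).

(* The union of the mu^(n): up to equivalence every formula in (x_i)_{i < omega}
   only involves x_0, ..., x_{n-1} for some n. *)
Definition morley_omega (M : ssubset U) X (mu : pform U X -> R)
    (phi : pform U (ccopies nat X)) : R :=
  xget 0 [set r | exists n (psi : pform U (ccopies 'I_n X)),
    pequiv (psubst (@widen_copies n X) psi) phi /\ r = morley_power M mu psi].

(* Av(a)(phi) for a = (a_0, ..., a_{n-1}) *)
Definition average X n (a : assign U (ccopies 'I_n X)) (phi : pform U X) : R :=
  (\sum_(i < n) `[< psat phi (fun v => a (i, v)) >]%:R) / n%:R.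

Definition fim (M : ssubset U) X (mu : pform U X -> R) : Prop :=
  borel_definable M mu /\
  forall Y (phi : formula (ccat X Y)), finctx Y ->
  exists theta : forall n, pform U (ccopies 'I_n X),
  [/\ forall n, fml_over M _ (theta n),
      (fun n => morley_power M mu (theta n)) @ \oo --> (1 : R) &
      forall eps : R, 0 < eps -> exists n_eps : nat,
        forall k, (n_eps <= k)%N ->
        forall a : assign U (ccopies 'I_k X), psat (theta k) a ->
        sup [set `| average a (pinst (plift U phi) b) -
                    mu (pinst (plift U phi) b) |
             | b in [set: assign U Y]] < eps].

(* lambda|_{xs, M} = mu^(omega)|_M and lambda|_y = nu *)
Definition left_restrict_eq (M : ssubset U) X Y
    (lambda : pform U (ccat X Y) -> R) (rho : pform U X -> R) : Prop :=
  forall phi, fml_over M X phi ->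
    lambda (psubst (fun x => @tvar L (ccat X Y) (inl x)) phi) = rho phi.

Definition right_restrict_eq X Y
    (lambda : pform U (ccat X Y) -> R) (nu : pform U Y -> R) : Prop :=
  forall phi,
    lambda (psubst (fun y => @tvar L (ccat X Y) (inr y)) phi) = nu phi.

(* psi(x, y) |-> psi(x_i, y) *)
Definition at_copy X Y (i : nat) :
    substitution (ccat X Y) (ccat (ccopies nat X) Y) :=
  fun w => match w as w
             return lterm (ccat (ccopies nat X) Y) (@srt _ (ccat X Y) w) with
  | inl x => @tvar L (ccat (ccopies nat X) Y) (inl (i, x))
  | inr y => @tvar L (ccat (ccopies nat X) Y) (inr y)
  end.

End keisler.
Arguments at_copy {L} X Y i.

(* Main.v *)
(** Since [mu] is fim over [M] and [M] is an elementary substructure, every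
    formula psi(x, w) admits a tuple a in M whose average Av(a)(psi(x, c))
    approximates mu(psi(x, c)) uniformly in c; integrating,
    mu (x) nu (psi) is approximated by the averages of nu(psi(a_i, w)).  These
    approximations show that the Morley powers of [mu] are Keisler measures
    and that they are invariant under passing to increasing subsequences of
    variables.  Hence, with theta_k given by fim, lambda gives
    theta_k(x_{g 0}, ..., x_{g (k-1)}) measure almost 1 for every increasing
    [g], so the average of the lambda(phi(x_{g j}, y, b)), j < k, is close to
    mu (x) nu (phi).  Consequently fewer than k indices can deviate upwards by
    more than eps, and fewer than k downwards.

    That [morley] is an integral at all needs a regular Borel probability on
    the type space extending [nu]: it is obtained by Caratheodory's theorem
    from the outer measure which on an open set is the supremum of [nu] over
    the clopen sets it contains; compactness gives countable subadditivity. *)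
Require Import Defs.
From HB Require Import structures.
From mathcomp Require Import all_boot all_order all_algebra.
From mathcomp Require Import all_classical all_reals all_analysis.
From mathcomp Require Import finmap zify lra.
Set Implicit Arguments.
Unset Strict Implicit.
Unset Printing Implicit Defensive.
Import Order.TTheory GRing.Theory Num.Theory.
Import numFieldNormedType.Exports.
Local Open Scope classical_set_scope.
Local Open Scope card_scope.
Local Open Scope ring_scope.

(** * Substitution and free variables *)

Section substitution_lemmas.
Context {L : language} (N : structure L).
Implicit Types X Y : ctx L.

Lemma assign_ext X (e e' : assign N X) : (forall v, e v = e' v) -> e = e'.
Proof. by move=> ee'; exact: functional_extensionality_dep. Qed.

Lemma teval_tsubst X Y (s : substitution X Y) t (a : lterm X t)
    (e : assign N Y) :
  teval e (tsubst s a) = teval (fun v => teval e (s v)) a.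
Proof.
elim: a => [v|f a ih] //=; congr (ifun _).
by apply: functional_extensionality_dep => i; exact: ih.
Qed.

Lemma teval_tweak X t (e : assign N X) (u : N t) r (a : lterm X r) :
  teval (vsnoc e u) (tsubst (@tweak L X t) a) = teval e a.
Proof. by rewrite teval_tsubst. Qed.

Lemma eval_subst_up X Y t (s : substitution X Y) (e : assign N Y) (u : N t) :
  (fun v => teval (vsnoc e u) (@subst_up L X Y t s v)) =
  vsnoc (fun v => teval e (s v)) u.
Proof. by apply: assign_ext => -[v|] //=; rewrite teval_tweak. Qed.

Lemma sat_fsubst X (phi : formula X) Y (s : substitution X Y)
    (e : assign N Y) :
  sat (fsubst s phi) e <-> sat phi (fun v => teval e (s v)).
Proof.
elim: phi Y s e => {X} [X|X t a b|X r a|X phi ih|X phi ih1 psi ih2|X t phi ih]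
  Y s e //=.
- by rewrite !teval_tsubst.
- have -> // : (fun i => teval e (tsubst s (a i))) =
    fun i => teval (fun v => teval e (s v)) (a i).
  by apply: functional_extensionality_dep => i; rewrite teval_tsubst.
- by rewrite ih.
- by rewrite ih1 ih2.
- by split=> -[u hu]; exists u; move: hu; rewrite ih eval_subst_up.
Qed.

End substitution_lemmas.

Section free_variables.
Context {L : language}.
Implicit Types X Y : ctx L.

Lemma tfv_tsubst X Y (s : substitution X Y) t (a : lterm X t) w :
  tfv (tsubst s a) w -> exists2 v, tfv a v & tfv (s v) w.
Proof.
elim: a => [v|f a ih] /=; first by exists v.
by move=> [i /ih[v av svw]]; exists v => //; exists i.
Qed.

Lemma fv_fsubst X (phi : formula X) Y (s : substitution X Y) w :
  fv (fsubst s phi) w -> exists2 v, fv phi v & tfv (s v) w.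
Proof.
elim: phi Y s w => {X} [X|X t a b|X r a|X phi ih|X phi ih1 psi ih2|X t phi ih]
  Y s w //=.
- by case=> /tfv_tsubst[v ? ?]; exists v => //; [left|right].
- by move=> [i /tfv_tsubst[v ? ?]]; exists v => //; exists i.
- exact: ih.
- by case=> [/ih1|/ih2] [v ? ?]; exists v => //; [left|right].
- move=> /ih[[v|] /= fvv]; last by [].
  by move=> /tfv_tsubst[z svz [->]]; exists v.
Qed.

Lemma finite_ordinal_union (T : Type) n (F : 'I_n -> set T) :
  (forall i, finite_set (F i)) -> finite_set [set v | exists i, F i v].
Proof.
move=> Ffin; rewrite (_ : [set v | _] = \bigcup_(i in [set: 'I_n]) F i).
  by apply: bigcup_finite => //; exact: finite_finset.
by apply/seteqP; split=> v [i] => [|_] ?; exists i.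
Qed.

Lemma finite_tfv X t (a : lterm X t) : finite_set (tfv a).
Proof.
elim: a => [v|f a ih] /=; first exact: finite_set1.
exact: finite_ordinal_union.
Qed.

Lemma finite_fv X (phi : formula X) : finite_set (fv phi).
Proof.
elim: phi => {X} [X|X t a b|X r a|X phi ih|X phi ih1 psi ih2|X t phi ih] //=.
- by rewrite finite_setU; split; exact: finite_tfv.
- by apply: finite_ordinal_union => i; exact: finite_tfv.
- by rewrite finite_setU.
- by apply: (@finite_preimage X (csnoc X t) (fv phi) Some) ih => x y _ _ [].
Qed.


Lemma tsubst_partial X t (a : lterm X t) Y
    (s : forall v, tfv a v -> lterm Y (srt v)) :
  exists a' : lterm Y t, forall (N : structure L) (e : assign N X)
    (e' : assign N Y),
    (forall v h, teval e' (s v h) = e v) -> teval e' a' = teval e a.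
Proof.
elim: a s => [v|f a ih] s /=.
  by exists (s v erefl) => N e e' ->.
have a'ex : forall i, exists a' : lterm Y (fdom i),
  forall (N : structure L) (e : assign N X) (e' : assign N Y),
    (forall v h, teval e' (s v h) = e v) -> teval e' a' = teval e (a i).
  move=> i; have [a' a'P] := ih i (fun v h => s v (ex_intro _ i h)).
  by exists a' => N e e' ee'; apply: a'P => v h; exact: ee'.
exists (tapp (fun i => sval (cid (a'ex i)))) => N e e' ee' /=; congr (ifun _).
by apply: functional_extensionality_dep => i;
  case: (cid (a'ex i)) => /= a' /(_ N e); apply.
Qed.



(** A parameter may have a counterpart in the new context only if it occurs in the formula, whereas
    a [substitution] must be total. *)
Lemma fsubst_partial X (phi : formula X) Y
    (s : forall v, fv phi v -> lterm Y (srt v)) :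
  exists phi' : formula Y, forall (N : structure L) (e : assign N X)
    (e' : assign N Y),
    (forall v h, teval e' (s v h) = e v) -> sat phi' e' <-> sat phi e.
Proof.
elim: phi Y s => {X} [X|X t a b|X r a|X phi ih|X phi ih1 psi ih2|X t phi ih]
  Y s /=.
- by exists ftrue.
- have [a' a'P] := tsubst_partial (fun v h => s v (or_introl h)).
  have [b' b'P] := tsubst_partial (fun v h => s v (or_intror h)).
  by exists (feq a' b') => N e e' ee' /=; rewrite (a'P N e) ?(b'P N e).
- have a'ex i := tsubst_partial (fun v h => s v (ex_intro _ i h)).
  exists (fatom (fun i => sval (cid (a'ex i)))) => N e e' ee' /=.
  rewrite (_ : (fun i => teval e' _) = fun i => teval e (a i)) //.
  apply: functional_extensionality_dep => i.
  by case: (cid (a'ex i)) => /= a' /(_ N e); apply.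
- have [phi' phi'P] := ih Y s.
  by exists (fnot phi') => N e e' ee' /=; rewrite (phi'P N e).
- have [phi' phi'P] := ih1 Y (fun v h => s v (or_introl h)).
  have [psi' psi'P] := ih2 Y (fun v h => s v (or_intror h)).
  by exists (fand phi' psi') => N e e' ee' /=; rewrite (phi'P N e) ?(psi'P N e).
(* An occurrence of [Some v] in the body is by computation an occurrence of [v] in the quantified
   formula, so [s] applies; the bound variable is kept. *)
- pose s' (o : csnoc X t) : fv phi o -> lterm (csnoc Y t) (srt o) :=
    match o as o return fv phi o -> lterm (csnoc Y t) (@srt _ (csnoc X t) o)
      with
    | Some v => fun h => tsubst (@tweak L Y t) (s v h)
    | None => fun=> @tvar L (csnoc Y t) None
    end.
  have [phi' phi'P] := ih (csnoc Y t) s'.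
  exists (fex phi') => N e e' ee' /=.
  have E u : sat phi' (vsnoc e' u) <-> sat phi (vsnoc e u).
    by apply: phi'P => -[v|] h //=; rewrite teval_tweak.
  by split=> -[u] /E ?; exists u.
Qed.

(** [fex] binds a variable outside the context. Redirecting every occurrence of [v] to that new
    variable quantifies over [v] while the context stays [X]. *)
Lemma exists_one_variable X (phi : formula X) (v : X) :
  exists phi' : formula X, forall (N : structure L) (e : assign N X),
    sat phi' e <-> exists2 e' : assign N X,
      (forall w, w <> v -> e' w = e w) & sat phi e'.
Proof.
pose s (w : X) : lterm (csnoc X (srt v)) (srt w) :=
  match pselect (v = w) with
  | left vw => eq_rect v (fun w => lterm (csnoc X (srt v)) (srt w))
      (@tvar L (csnoc X (srt v)) None) w vw
  | right _ => @tvar L (csnoc X (srt v)) (Some w)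
  end.
have s_old (N : structure L) (e : assign N X) u w :
    w <> v -> teval (vsnoc e u) (s w) = e w.
  by rewrite /s; case: pselect => // vw /(_ (esym vw)).
have s_new (N : structure L) (e : assign N X) u :
    teval (vsnoc e u) (s v) = u.
  (* Proof irrelevance turns the equality [p : v = v] into [erefl], so that the transport
     computes. *)
  by rewrite /s; case: pselect => // p; rewrite (Prop_irrelevance p erefl).
exists (fex (fsubst s phi)) => N e /=; split.
  move=> [u]; rewrite sat_fsubst => h.
  by exists (fun w => teval (vsnoc e u) (s w)) => // w wv; rewrite s_old.
move=> [e' ee' h]; exists (e' v); rewrite sat_fsubst.
rewrite (_ : (fun w => _) = e') //; apply: assign_ext => w.
by have [->|wv] := pselect (w = v); rewrite ?s_new// s_old// ee'.
Qed.

(** The variables in [D] are quantified one at a time. The equivalence holds in every structure, so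
    one formula serves both the submodel and [U]. *)
Lemma exists_finite_variables X (phi : formula X) (D : set X) : finite_set D ->
  exists phi' : formula X, forall (N : structure L) (e : assign N X),
    sat phi' e <-> exists2 e' : assign N X,
      (forall w, ~ D w -> e' w = e w) & sat phi e'.
Proof.
move=> /finite_setP[n]; elim: n D => [|n ih] D.
  rewrite II0 card_eq0 => /eqP ->; exists phi => N e; split=> [h|[e' ee' h]].
    by exists e.
  by rewrite (_ : e = e') //; apply: assign_ext => w; rewrite ee'.
move=> /eq_cardSP[v Dv] /ih[psi psiP].
have [phi' phi'P] := exists_one_variable psi v.
exists phi' => N e; rewrite phi'P; split.
  move=> [e1 ee1] /psiP[e2 e12 h]; exists e2 => // w Dw.
  by rewrite e12 ?ee1//; [move=> wv; apply: Dw; rewrite wv|case].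
move=> [e2 ee2 h].
(* First change only [v], to its value under [e2]; the rest of [D] is changed afterwards. *)
pose e1 : assign N X := fun w => if pselect (D w /\ w <> v) then e w else e2 w.
exists e1.
  by rewrite /e1 => w wv; case: pselect => // Dw; apply: ee2 => ?; apply: Dw.
apply/psiP; exists e2 => // w Dw.
by rewrite /e1; case: pselect.
Qed.


End free_variables.

(** * Formulas with parameters *)

Section formulas_with_parameters.
Context {L : language} (U : structure L).
Implicit Types X Y Z W : ctx L.

(* psi(a, y) *)
Definition linst X Y (psi : pform U (ccat X Y)) (a : assign U X) : pform U Y :=
  fsubst (fun w : ccat (ccat X Y) (params U) =>
    match w as w
      return lterm (ccat Y (params U)) (@srt _ (ccat (ccat X Y) (params U)) w)
    with
    | inl (inl x) =>
        @tvar L (ccat Y (params U)) (inr (existT U (srt x) (a x)))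
    | inl (inr y) => @tvar L (ccat Y (params U)) (inl y)
    | inr p => @tvar L (ccat Y (params U)) (inr p)
    end) psi.

Lemma psat_plift X (phi : formula X) (e : assign U X) :
  psat (plift U phi) e <-> sat phi e.
Proof. exact: sat_fsubst. Qed.

Lemma psat_pinst X Y (psi : pform U (ccat X Y)) (c : assign U Y)
    (e : assign U X) :
  psat (pinst psi c) e <-> psat psi (vcat e c).
Proof.
rewrite /psat /pinst sat_fsubst.
by rewrite (_ : (fun v => teval _ _) = vcat (vcat e c) (fun a : params U =>
  projT2 a))//;
  apply: assign_ext => -[[]|].
Qed.

Lemma psat_linst X Y (psi : pform U (ccat X Y)) (a : assign U X)
    (e : assign U Y) :
  psat (linst psi a) e <-> psat psi (vcat a e).
Proof.
rewrite /psat /linst sat_fsubst.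
by rewrite (_ : (fun v => teval _ _) = vcat (vcat a e) (fun a : params U =>
  projT2 a))//;
  apply: assign_ext => -[[]|].
Qed.

Lemma psat_psubst X Y (s : substitution X Y) (psi : pform U X)
    (e : assign U Y) :
  psat (psubst s psi) e <-> psat psi (fun v => teval e (s v)).
Proof.
rewrite /psat /psubst sat_fsubst.
rewrite (_ : (fun v => teval _ _) =
  vcat (fun v => teval e (s v)) (fun a : params U => projT2 a))//.
by apply: assign_ext => -[v|a] //=; rewrite teval_tsubst.
Qed.

Lemma params_psubst X Y (s : substitution X Y) (psi : pform U X) t u :
  params_of (psubst s psi) t u -> params_of psi t u.
Proof.
by move=> /fv_fsubst[[v|p] h] /= => [/tfv_tsubst[]//|[pE]];
  rewrite /params_of/= pE.
Qed.

Lemma fml_over_psubst (A : ssubset U) X Y (s : substitution X Y)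
    (psi : pform U X) :
  fml_over A X psi -> fml_over A Y (psubst s psi).
Proof. by move=> psiA t u /params_psubst /psiA. Qed.

Lemma fml_over_linst (A : ssubset U) X Y (psi : pform U (ccat X Y))
    (a : assign U X) :
  fml_over A _ psi -> (forall v, A _ (a v)) -> fml_over A Y (linst psi a).
Proof.
move=> psiA aA t u /fv_fsubst[[[x|y]|p] h] //=.
  move=> /(congr1 (fun o : Y + params U => if o is inr q then q else existT U t
    u)).
  move=> /= /(congr1 (fun q : params U => A _ (projT2 q))) /= ->; exact: aA.
by move=> [pE]; apply: psiA; rewrite /params_of/= pE.
Qed.

Lemma fml_over_fnot (A : ssubset U) X (psi : pform U X) :
  fml_over A X psi -> fml_over A X (fnot psi).
Proof. by []. Qed.

Lemma fml_over_fand (A : ssubset U) X (psi chi : pform U X) :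
  fml_over A X psi -> fml_over A X chi -> fml_over A X (fand psi chi).
Proof. by move=> psiA chiA t u [/psiA|/chiA]. Qed.

Lemma finite_params X (psi : pform U X) : finite_set (tot (params_of psi)).
Proof.
rewrite (_ : tot _ = [set p : params U | fv psi (inr p)]).
  by apply: (@finite_preimage (params U) (ccat X (params U)) (fv psi) inr)
    (finite_fv psi) => p q _ _ [].
by apply/seteqP; split=> -[t u].
Qed.

Lemma psat_f_or X (psi chi : pform U X) e :
  psat (f_or psi chi) e <-> psat psi e \/ psat chi e.
Proof.
rewrite /psat/=; split=> [h|[h|h] []//].
by apply: contrapT => h'; apply: h; split=> ?; apply: h'; [left|right].
Qed.

(** Fim speaks of formulas without parameters. The finitely many parameters that occur become a
    finite tuple [Z] of variables, and [b] interprets each by itself. *)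
Lemma pform_decompose X W (psi : pform U (ccat X W)) :
  exists (Z : ctx L) (phi : formula (ccat X (ccat W Z))) (b : assign U Z),
    finctx Z /\
    forall x w, psat psi (vcat x w) <-> sat phi (vcat x (vcat w b)).
Proof.
pose D := [set p : params U | fv psi (inr p)].
pose Z : ctx L := Ctx (fun p : set_type D => srt (set_val p)).
pose b : assign U Z := fun p => projT2 (set_val p).
pose s (v : ccat (ccat X W) (params U)) :
    fv psi v -> lterm (ccat X (ccat W Z)) (srt v) :=
  match v as v return fv psi v -> lterm (ccat X (ccat W Z))
    (@srt _ (ccat (ccat X W) (params U)) v) with
  | inl (inl x) => fun=> @tvar L (ccat X (ccat W Z)) (inl x)
  | inl (inr w) => fun=> @tvar L (ccat X (ccat W Z)) (inr (inl w))
  | inr p => fun h => @tvar L (ccat X (ccat W Z)) (inr (inr (SigSub (mem_set (h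
    : D p)))))
  end.
have [phi phiP] := fsubst_partial s.
exists Z, phi, b; split; last first.
  move=> x w; rewrite /psat -(phiP U _ (vcat x (vcat w b))) //.
  by move=> [[x'|w']|p] h.
rewrite /finctx (eq_finite_set (card_setT D)).
by apply: (@finite_preimage (params U) (ccat (ccat X W) (params U)) (fv psi)
  inr)
  (finite_fv psi) => p q _ _ [].
Qed.

End formulas_with_parameters.

(** * Finitely additive integration and approximation by averages *)

Section finite_contexts.
Context {L : language}.
Implicit Types X Y : ctx L.

Lemma finctx_ccat X Y : finctx X -> finctx Y -> finctx (ccat X Y).
Proof.
move=> Xfin Yfin; rewrite /finctx.
rewrite (_ : [set: _] = inl @` [set: X] `|` inr @` [set: Y]).
  by rewrite finite_setU; split; exact: finite_image.
by apply/seteqP; split=> // -[x|y] _; [left; exists x|right; exists y].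
Qed.

Lemma finctx_ccopies n X : finctx X -> finctx (ccopies 'I_n X).
Proof.
move=> Xfin; rewrite /finctx.
rewrite (_ : [set: _] = [set: 'I_n] `*` [set: X]).
  by apply: finite_setX => //; exact: finite_finset.
by apply/seteqP; split.
Qed.

End finite_contexts.

Section realization_in_submodel.
Context {L : language} (U : structure L).

(** Parameters from [M] become variables, the block [W] is quantified existentially, and
    elementarity carries the existential formula to the submodel, which supplies a witness. *)
Lemma realized_in_submodel (M : ssubset U) (hM : elementary_substructure M)
    (W : ctx L) (theta : pform U W) : finctx W -> fml_over M W theta ->
  (exists e : assign U W, psat theta e) ->
  exists2 e : assign U W, (forall v, M _ (e v)) & psat theta e.
Proof.
move: hM => [ne [cl MU]] Wfin thetaM [e he].
pose D := [set p : params U | M _ (projT2 p)].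
pose V : ctx L := Ctx (fun p : set_type D => srt (set_val p)).
have DM (v : ccat W (params U)) (h : fv theta v) :
    if v is inr p then D p else True.
  by case: v h => // -[t u] h; exact: thetaM.
pose s (v : ccat W (params U)) : fv theta v -> lterm (ccat W V) (srt v) :=
  match v as v return fv theta v ->
    lterm (ccat W V) (@srt _ (ccat W (params U)) v) with
  | inl w => fun=> @tvar L (ccat W V) (inl w)
  | inr p => fun h => @tvar L (ccat W V) (inr (SigSub (mem_set (DM (inr p) h))))
  end.
have [chi chiP] := fsubst_partial s.
have chiU (c : assign U W) :
    sat chi (vcat c (fun p : V => projT2 (set_val p))) <-> psat theta c.
  by apply: chiP => -[w|p] h.
have [ex_chi ex_chiP] := exists_finite_variables chi (finite_image inl Wfin).
pose N := substructure ne cl.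
(* The values on [W] are arbitrary, since [ex_chi] quantifies them away. *)
pose e0 : assign N (ccat W V) := vcat (fun w : W => projT1 (cid (car_nonempty N
  (srt w))))
  (fun p : V => exist _ (projT2 (set_val p)) (set_valP p)).
have : sat (N := U) ex_chi (fun v => sval (e0 v)).
  apply/ex_chiP.
  exists (vcat e (fun p : V => projT2 (set_val p))); last exact/chiU.
  by move=> [w|p] //= []; exists w.
move=> /MU/ex_chiP[e1 e01 /MU].
rewrite (_ : (fun v => sval (e1 v)) = vcat (fun w => sval (e1 (inl w)))
  (fun p : V => projT2 (set_val p))); last first.
  by apply: assign_ext => -[w|p] //=; rewrite e01//= => -[].
move=> /chiU h; exists (fun w => sval (e1 (inl w))) => //.
by move=> w; exact: svalP (e1 (inl w)).
Qed.

End realization_in_submodel.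

Section keisler_measures.
Context {R : realType} {L : language} (U : structure L) (X : ctx L).
Variable nu : pform U X -> R.
Hypothesis nuK : keisler nu.
Implicit Types f g : pform U X.

Lemma keisler_equiv f g : pequiv f g -> nu f = nu g.
Proof. by case: nuK => h _ _ _; exact: h. Qed.

Lemma keisler_ge0 f : 0 <= nu f.
Proof. by case: nuK. Qed.

Lemma keisler_disjoint f g h : (forall e, ~ (psat f e /\ psat g e)) ->
  (forall e, psat h e <-> psat f e \/ psat g e) -> nu h = nu f + nu g.
Proof.
move=> fg hfg; case: nuK => _ _ _ <- //.
by apply: keisler_equiv => e; rewrite hfg psat_f_or.
Qed.

Lemma keisler_unsat f : (forall e, ~ psat f e) -> nu f = 0.
Proof.
move=> f0; have : nu f = nu f + nu f.
  by apply: keisler_disjoint => e; [case=> /f0|split=> [/f0|[|]/f0]].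
lra.
Qed.

Lemma keisler_split f g : nu g = nu (fand f g) + nu (fand (fnot f) g).
Proof.
apply: keisler_disjoint => e; first by case=> -[? ?] [].
by rewrite /psat/=; set A := sat f _; have [] := pselect A; tauto.
Qed.

Lemma keisler_valid f : (forall e, psat f e) -> nu f = 1.
Proof. by move=> fT; case: nuK => h _ <- _; apply: h => e; split. Qed.

Lemma keisler_not f : nu (fnot f) = 1 - nu f.
Proof.
rewrite -(@keisler_valid ftrue)// (@keisler_disjoint f (fnot f) ftrue)//.
- lra.
- by move=> e [].
- by move=> e; split=> // _; exact: EM.
Qed.

Lemma keisler_le1 f : nu f <= 1.
Proof. by have := keisler_not f; have := keisler_ge0 (fnot f); lra. Qed.

Lemma keisler_le f g : (forall e, psat f e -> psat g e) -> nu f <= nu g.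
Proof.
move=> fg; rewrite (keisler_split f g) (_ : nu (fand f g) = nu f).
  by have := keisler_ge0 (fand (fnot f) g); lra.
by apply: keisler_equiv => e; split=> [[]//|h]; split=> //; exact: fg.
Qed.

Definition ind f (e : assign U X) : R := `[< psat f e >]%:R.

(** Positivity of the integral of simple functions. The induction splits [g] along the first formula
    [f]: on [f] the remaining terms sum to at least [t - c], off [f] to at least [t]. Hence the
    statement is relative to [g]. *)
Lemma keisler_sum_ge (s : seq (R * pform U X)) g t :
  (forall e, psat g e -> t <= \sum_(p <- s) p.1 * ind p.2 e) ->
  t * nu g <= \sum_(p <- s) p.1 * nu (fand p.2 g).
Proof.
elim: s g t => [|[c f] s ih] g t hg.
  rewrite big_nil; have [[e /hg]|g0] := pselect (exists e, psat g e).
    by rewrite big_nil => ?; rewrite mulr_le0_ge0// keisler_ge0.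
  by rewrite keisler_unsat ?mulr0// => e ge; apply: g0; exists e.
rewrite big_cons /=.
have h1 : (t - c) * nu (fand f g) <=
    \sum_(p <- s) p.1 * nu (fand p.2 (fand f g)).
  apply: ih => e [fe ge]; have := hg e ge.
  by rewrite big_cons /ind (asboolT fe)/=; lra.
have h2 : t * nu (fand (fnot f) g) <=
    \sum_(p <- s) p.1 * nu (fand p.2 (fand (fnot f) g)).
  apply: ih => e [fe ge]; have := hg e ge.
  by rewrite big_cons /ind (asboolF fe)/=; lra.
have -> : \sum_(p <- s) p.1 * nu (fand p.2 g) =
    \sum_(p <- s) p.1 * nu (fand p.2 (fand f g)) +
    \sum_(p <- s) p.1 * nu (fand p.2 (fand (fnot f) g)).
  rewrite -big_split/=; apply: eq_bigr => p _.
  rewrite -mulrDr (keisler_split f); congr (_ * (_ + _));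
    by apply: keisler_equiv => e; rewrite /psat/=; tauto.
by rewrite [nu g](keisler_split f); lra.
Qed.

(** A relation, because [F] has many presentations as a combination of indicators; for a Keisler
    measure, [simple_integral_le] shows that all give the same value. *)
Definition simple_integral (F : assign U X -> R) (r : R) :=
  exists s : seq (R * pform U X),
    (forall e, F e = \sum_(p <- s) p.1 * ind p.2 e) /\
    r = \sum_(p <- s) p.1 * nu p.2.

Lemma simple_integral_ind f : simple_integral (ind f) (nu f).
Proof. by exists [:: (1, f)]; split=> [e|]; rewrite big_seq1 mul1r. Qed.

Lemma simple_integral_cst c : simple_integral (fun=> c) c.
Proof.
exists [:: (c, ftrue)]; split=> [e|]; rewrite big_seq1/= ?/ind.
  by rewrite asboolT ?mulr1.
by rewrite keisler_valid ?mulr1.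
Qed.

Lemma simple_integralD F G r r' : simple_integral F r ->
  simple_integral G r' -> simple_integral (fun e => F e + G e) (r + r').
Proof.
move=> [s [sF ->]] [s' [sG ->]]; exists (s ++ s').
by split=> [e|]; rewrite big_cat// sF sG.
Qed.

Lemma simple_integralZ c F r : simple_integral F r ->
  simple_integral (fun e => c * F e) (c * r).
Proof.
move=> [s [sF ->]]; exists [seq (c * p.1, p.2) | p <- s].
by split=> [e|]; rewrite big_map/= ?sF mulr_sumr; apply: eq_bigr => p _;
  rewrite mulrA.
Qed.

Lemma simple_integral_sum n (F : 'I_n -> assign U X -> R) r :
  (forall i, simple_integral (F i) (r i)) ->
  simple_integral (fun e => \sum_i F i e) (\sum_i r i).
Proof.
move=> Fr; elim: n => [|n ih] in F r Fr *.
  rewrite (_ : (fun=> _) = fun=> 0) ?big_ord0; first exact: simple_integral_cst.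
  by apply: funext => e; rewrite big_ord0.
rewrite big_ord_recl (_ : (fun=> _) =
    fun e => F ord0 e + \sum_i F (lift ord0 i) e).
  by apply: simple_integralD => //; exact: ih.
by apply: funext => e; rewrite big_ord_recl.
Qed.

(** [G - F] is a combination of indicators that is nonnegative everywhere, so [keisler_sum_ge]
    applies with the true formula and bound 0. *)
Lemma simple_integral_le F G r r' : simple_integral F r ->
  simple_integral G r' -> (forall e, F e <= G e) -> r <= r'.
Proof.
move=> Fr Gr FG.
have [s [sE sI]] := simple_integralD Gr (simple_integralZ (-1) Fr).
rewrite -subr_ge0 -mulN1r sI.
have := @keisler_sum_ge s ftrue 0; rewrite mul0r => h.
apply: (le_trans (h _)) => [e _|].
  by rewrite -sE mulN1r subr_ge0.
rewrite le_eqVlt; apply/orP; left; apply/eqP.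
apply: eq_bigr => p _; congr (_ * _).
by apply: keisler_equiv => e; rewrite /psat/=; tauto.
Qed.

End keisler_measures.

(** * Approximating tuples in the small model *)

Section fim_approximation.
Context {R : realType} {L : language} (U : structure L) (M : ssubset U).
Implicit Types X Y W : ctx L.

(** This holds before the defining integral is known to exist: the fibres vanish, and the default
    values of [fiber] and [morley] are also 0. It lets positive measure imply satisfiability at a
    stage where additivity of [morley] is still open. *)
Lemma morley_unsat X W (mu : pform U X -> R) (nu : pform U W -> R)
    (psi : pform U (ccat X W)) : keisler mu ->
  (forall e, ~ psat psi e) -> morley M mu nu psi = 0.
Proof.
move=> muK psi0; rewrite /morley.
case: xgetP => [r _ [P _ rE]|//].
apply: EFin_inj; rewrite rE; apply: integral0_eq => q _.
rewrite /fiber; case: xgetP => [x _ [c _ ->]|//].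
by rewrite (keisler_unsat muK) // => e /psat_pinst /psi0.
Qed.

Lemma morley_power_unsat X (mu : pform U X -> R) n
    (theta : pform U (ccopies 'I_n X)) : keisler mu ->
  (forall e, ~ psat theta e) -> morley_power M mu theta = 0.
Proof.
move=> muK; case: n theta => [|n] theta theta0 /=.
  rewrite asboolF// => h; exact: theta0 (h (@some_val L U _)).
by apply: morley_unsat => // e /psat_psubst /theta0.
Qed.

Definition approximates X W (mu : pform U X -> R) (psi : pform U (ccat X W))
    (eps : R) k (a : assign U (ccopies 'I_k X)) :=
  forall c : assign U W,
    `|average a (pinst psi c) - mu (pinst psi c)| <= eps.

Lemma average_ge0 X k (a : assign U (ccopies 'I_k X)) (psi : pform U X) :
  (0 : R) <= average a psi.
Proof. by rewrite divr_ge0// sumr_ge0. Qed.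

Lemma average_le1 X k (a : assign U (ccopies 'I_k X)) (psi : pform U X) :
  average a psi <= 1 :> R.
Proof.
case: k a => [|k] a; first by rewrite /average invr0 mulr0.
rewrite /average ler_pdivrMr ?ltr0n// mul1r.
rewrite -[leRHS](_ : \sum_(i < k.+1) 1 = _).
  by apply: ler_sum => i _; case: `[< _ >].
by rewrite sumr_const card_ord.
Qed.

Lemma fim_formula X Y (mu : pform U X -> R) (phi : formula (ccat X Y))
    (eps : R) : keisler mu -> fim M mu -> finctx Y -> 0 < eps ->
  exists k (theta : pform U (ccopies 'I_k X)),
    [/\ (0 < k)%N, fml_over M _ theta, 1 - eps < morley_power M mu theta &
        forall a, psat theta a -> approximates mu (plift U phi) eps a].
Proof.
move=> muK [_ fimmu] Yfin eps0.
have [theta [thetaM theta1 thetaP]] := fimmu Y phi Yfin.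
have [n nP] := thetaP eps eps0.
have /cvgrPdist_lt /(_ eps eps0) [m _ mP] := theta1.
(* [n] serves the error bound and [m] the limit; the 1 keeps averages from dividing by zero. *)
pose k := maxn (maxn n m) 1.
exists k, (theta k); split=> //.
- by rewrite /k leq_max orbT.
- have /= := mP k; rewrite /k !leq_max leqnn orbT/= => /(_ isT).
  by rewrite ltr_norml => /andP[_]; lra.
- move=> a thetaa b; apply/ltW; apply: le_lt_trans (nP k _ a thetaa).
    apply: ub_le_sup; last by exists b.
    (* The errors are bounded by 2, so [sup] is a genuine supremum and dominates each of them. *)
    exists (1 + 1) => _ [b' _ <-]; rewrite (le_trans (ler_normB _ _))//.
    apply: lerD; first by rewrite ger0_norm ?average_ge0 ?average_le1.
    by rewrite ger0_norm ?(keisler_ge0 muK) ?(keisler_le1 muK).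
  by rewrite /k !leq_max leqnn.
Qed.

(** Along [h], every fibre of [psi'] is a fibre of [psi]. This moves one tuple [a] between formulas
    that differ in parameters or in the arrangement of variables. *)
Lemma approximates_equiv X W W' (mu : pform U X -> R)
    (psi : pform U (ccat X W)) (psi' : pform U (ccat X W'))
    (h : assign U W' -> assign U W) eps k (a : assign U (ccopies 'I_k X)) :
  keisler mu ->
  (forall x c, psat psi' (vcat x c) <-> psat psi (vcat x (h c))) ->
  approximates mu psi eps a -> approximates mu psi' eps a.
Proof.
move=> muK psiE ap c; have := ap (h c).
have E : pequiv (pinst psi' c) (pinst psi (h c)).
  by move=> x; rewrite !psat_pinst.
rewrite (keisler_equiv muK E) (_ : average a (pinst psi (h c)) =
  average a (pinst psi' c)) //.
by congr (_ / _); apply: eq_bigr => i _; congr (_%:R);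
  congr nat_of_bool; apply: asbool_equiv_eq; split=> /E.
Qed.

(** The formula [theta] has positive measure, so it is satisfiable, and by elementarity it is
    realized in [M]. The parameters of [psi] count among the variables over which fim is uniform. *)
Lemma fim_approximation (hM : elementary_substructure M) X W
    (mu : pform U X -> R) (psi : pform U (ccat X W)) (eps : R) :
  finctx X -> finctx W -> keisler mu -> fim M mu -> 0 < eps ->
  exists k (a : assign U (ccopies 'I_k X)),
    [/\ (0 < k)%N, forall v, M (a v) & approximates mu psi eps a].
Proof.
move=> Xfin Wfin muK mufim eps0.
have [Z [phi [b [Zfin phiP]]]] := pform_decompose psi.
(* Capping the error at 1 keeps the lower bound on the measure of [theta] nonnegative. *)
have e0 : 0 < Num.min eps 1 by rewrite lt_min eps0 ltr01.
have [k [theta [k0 thetaM theta1 thetaP]]] :=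
  fim_formula phi muK mufim (finctx_ccat Wfin Zfin) e0.
have [a aM thetaa] : exists2 a, (forall v, M (a v)) & psat theta a.
  apply: realized_in_submodel => //; first exact: finctx_ccopies.
  apply: contrapT => theta0.
  move: theta1; rewrite morley_power_unsat//; last first.
    by move=> e he; apply: theta0; exists e.
  by rewrite subr_lt0 lt_min ltxx andbF.
exists k, a; split=> //.
apply: (@approximates_equiv _ _ _ _ (plift U phi) _ (fun c => vcat c b)) => //.
  by move=> x c; rewrite psat_plift; exact: phiP.
by move=> c; apply: le_trans (thetaP a thetaa c) _; rewrite ge_min lexx.
Qed.

End fim_approximation.

(** * Type spaces *)

Section stone_space.
Context {L : language} (U : structure L) (X : ctx L) (A : ssubset U).
Implicit Types (f g : pform U X) (q : stone U X A) (O : set (stone U X A)).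

Lemma stone_over q f : tset q f -> fml_over A X f.
Proof. by case: q => p [pA _ _] /= /pA. Qed.

Lemma stone_em q f : fml_over A X f -> tset q f \/ tset q (fnot f).
Proof. by case: q => p [_ pm _] /= /pm. Qed.

Lemma stone_sat q (B : set (pform U X)) : finite_set B -> B `<=` tset q ->
  exists e : assign U X, forall f, B f -> psat f e.
Proof. by case: q => p [_ _ pfs] /=; exact: pfs. Qed.

Lemma stone_imply q f g : fml_over A X g -> tset q f ->
  (forall e, psat f e -> psat g e) -> tset q g.
Proof.
move=> gA qf fg; have [//|qg] := stone_em q gA.
have [||e eP] := @stone_sat q [set f; fnot g].
  by rewrite finite_setU; split; exact: finite_set1.
  by move=> h [->|->].
have /fg := eP f (or_introl erefl).
by have := eP (fnot g) (or_intror erefl).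
Qed.

Lemma stone_and q f g : tset q f -> tset q g -> tset q (fand f g).
Proof.
move=> qf qg; have fA := stone_over qf; have gA := stone_over qg.
have [//|qfg] := stone_em q (fml_over_fand fA gA).
have [||e eP] := @stone_sat q ([set f; g] `|` [set fnot (fand f g)]).
  by rewrite !finite_setU; split; [split|]; exact: finite_set1.
  by move=> h [[->|->]|->].
have ef := eP f (or_introl (or_introl erefl)).
have eg := eP g (or_introl (or_intror erefl)).
by case: (eP (fnot (fand f g)) (or_intror erefl)).
Qed.

Lemma stone_not q f : fml_over A X f -> tset q (fnot f) <-> ~ tset q f.
Proof.
move=> fA; split=> [qn qf|]; last by have [] := stone_em q fA.
have [e [h1 h2]] : exists e : assign U X, psat (fand f (fnot f)) e.
  have [||e eP] := @stone_sat q [set fand f (fnot f)].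
  - exact: finite_set1.
  - by move=> h ->; exact: stone_and.
  - by exists e; exact: eP.
exact: h2.
Qed.

Lemma clopen_ofT : clopen_of (A := A) (@ftrue L (ccat X (params U))) = setT.
Proof.
apply/seteqP; split=> // q _; have [//|h] := @stone_em q ftrue (fun t u h =>
  False_ind _ h).
have [||e] := @stone_sat q [set fnot ftrue].
- exact: finite_set1.
- by move=> f ->.
- by move/(_ _ erefl) => [].
Qed.

Lemma clopen_ofI f g : fml_over A X f -> fml_over A X g ->
  clopen_of (A := A) (fand f g) = clopen_of f `&` clopen_of g.
Proof.
move=> fA gA; apply/seteqP; split=> q => [h|[]]; last exact: stone_and.
by split; apply: stone_imply h _ => // e [].
Qed.

Lemma clopen_ofC f : fml_over A X f -> clopen_of (A := A) (fnot f) = ~`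
  clopen_of f.
Proof. by move=> fA; apply/seteqP; split=> q /(stone_not _ fA). Qed.

Lemma clopen_of0 :
  clopen_of (A := A) (@fnot L (ccat X (params U)) ftrue) = set0.
Proof. by rewrite clopen_ofC ?clopen_ofT ?setCT//; move=> t u []. Qed.

Lemma clopen_ofU f g : fml_over A X f -> fml_over A X g ->
  clopen_of (A := A) (f_or f g) = clopen_of f `|` clopen_of g.
Proof.
move=> fA gA; rewrite /f_or clopen_ofC; last first.
  by apply: fml_over_fand; exact: fml_over_fnot.
by rewrite clopen_ofI// !clopen_ofC// setCI !setCK.
Qed.

Lemma clopen_of_tp f e : fml_over A X f -> clopen_of f (tp A e) <-> psat f e.
Proof. by move=> fA; split=> [[]|]. Qed.

Lemma clopen_of_sub f g : fml_over A X f -> fml_over A X g ->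
  clopen_of (A := A) f `<=` clopen_of g <-> (forall e, psat f e -> psat g e).
Proof.
move=> fA gA; split=> [fg e fe|fg q qf]; last exact: stone_imply qf fg.
by apply/(clopen_of_tp _ gA)/fg/clopen_of_tp.
Qed.

Lemma open_clopen_of f : fml_over A X f -> open (clopen_of (A := A) f).
Proof.
move=> fA.
exists [set clopen_of f]; last by rewrite bigcup_set1.
move=> _ ->; exists [fset clopen_of f]%fset.
  by move=> B; rewrite inE => /eqP ->; apply/mem_set; exists f.
by rewrite set_fset1 bigcap_set1.
Qed.

Lemma clopen_bigcap (s : seq (set (stone U X A))) :
  (forall C, C \in s -> exists2 f, fml_over A X f & clopen_of f = C) ->
  exists2 f, fml_over A X f & clopen_of f = [set q | forall C, C \in s -> C q].
Proof.
elim: s => [|C s ih] sP.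
  exists ftrue; first by move=> t u [].
  by rewrite clopen_ofT; apply/seteqP; split.
have [|f fA fE] := ih; first by move=> B Bs; apply: sP; rewrite inE Bs orbT.
have [|g gA gE] := sP C; first by rewrite inE eqxx.
exists (fand g f); first exact: fml_over_fand.
rewrite clopen_ofI// fE gE; apply/seteqP; split=> q.
  by move=> [Cq sq] B; rewrite inE => /orP[/eqP -> //|]; exact: sq.
move=> h; split=> [|B Bs]; first by apply: h; rewrite inE eqxx.
by apply: h; rewrite inE Bs orbT.
Qed.

Lemma open_clopen_base O q : open O -> O q ->
  exists f, [/\ fml_over A X f, tset q f & clopen_of f `<=` O].
Proof.
move=> [D' sD' <-] [B D'B Bq].
have [E sE EB] := sD' _ D'B; rewrite -EB in Bq D'B.
have [C /sE/set_mem[f ? <-]|f fA fE] := @clopen_bigcap (enum_fset E);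
  first by exists f.
exists f; split=> //; first by rewrite -[tset q f]/(clopen_of f q) fE => C /Bq.
move=> p; rewrite fE => pE; exists B; first by rewrite -EB.
by rewrite -EB; exact: pE.
Qed.

(** An ultrafilter converges to the type of all formulas whose clopen set it contains. Finitely many
    of these sets meet in a set of the filter; any type in it shows that the formulas are jointly
    satisfiable. *)
Lemma stone_compact : compact [set: stone U X A].
Proof.
rewrite compact_ultra => F FF _.
pose p : set (pform U X) := [set f | fml_over A X f /\ F (clopen_of f)].
have pP : complete_type A p.
  split=> [f []//|f fA|B Bfin Bp].
    have [h|h] := in_ultra_setVsetC (clopen_of f) FF; [left|right]; split=> //.
    by rewrite clopen_ofC.
  have [q qB] : exists q : stone U X A, forall f, B f -> tset q f.
    have : F (\bigcap_(f in B) clopen_of (A := A) f).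
      have [s sB] := (@finite_fsetP {classic pform U X} B).1 Bfin.
      rewrite sB; apply: (@filter_bigI _ {classic pform U X} s (fun f =>
        clopen_of f) F) => f /= fs.
      by have [] : p f by apply: Bp; rewrite sB.
    by move=> /filter_ex[q qB]; exists q.
  by apply: (@stone_sat q) => // f; exact: qB.
exists (Stone pP); split=> // V; rewrite nbhsE => -[G [Go Gp] GV].
have [f [fA [_ Ff] fO]] := open_clopen_base Go Gp.
by apply: filterS Ff => q /fO/GV.
Qed.

Lemma closed_clopen_of f : fml_over A X f -> closed (clopen_of (A := A) f).
Proof.
by move=> fA; rewrite -[clopen_of f]setCK -clopen_ofC//;
  apply/open_closedC/open_clopen_of.
Qed.

Lemma clopen_bigor (T : eqType) (l : seq T) (P : pred T) (F : T -> pform U X) :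
  (forall p, p \in l -> P p -> fml_over A X (F p)) ->
  let g := \big[@f_or L (ccat X (params U))/fnot ftrue]_(p <- l | P p) F p in
  fml_over A X g /\
  forall q, clopen_of (A := A) g q <->
    exists2 p, p \in l & P p && `[< clopen_of (F p) q >].
Proof.
elim: l => [|p l ih] lA /=.
  rewrite big_nil; split=> [t u []//|q].
  by rewrite clopen_of0; split=> // -[].
have [|gA gE] := ih.
  by move=> p' pl; apply: lA; rewrite inE pl orbT.
rewrite big_cons; case: ifPn => Pp.
  have pA : fml_over A X (F p) by apply: lA; rewrite ?mem_head.
  split=> [|q].
    by apply: fml_over_fnot; apply: fml_over_fand; exact: fml_over_fnot.
  rewrite clopen_ofU//; split=> [[h|/gE[p' pl Pp']]|[p' + Pp']].
  - by exists p; rewrite ?mem_head// Pp; exact/asboolP.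
  - by exists p' => //; rewrite inE pl orbT.
  - rewrite inE => /orP[/eqP pp|pl]; last by right; apply/gE; exists p'.
    by left; move: Pp'; rewrite pp => /andP[_ /asboolP].
split=> // q; split=> [/gE[p' pl Pp']|[p' + Pp']].
  by exists p' => //; rewrite inE pl orbT.
rewrite inE => /orP[/eqP pp|pl]; last by apply/gE; exists p'.
by move: Pp'; rewrite pp (negbTE Pp).
Qed.

(** Refine the cover to clopen sets, each labelled by an index [i] with the set inside [O i];
    extract a finite subcover and take, for each label, the disjunction of its pieces. *)
Lemma clopen_cover f (O : nat -> set (stone U X A)) : fml_over A X f ->
  (forall n, open (O n)) -> clopen_of f `<=` \bigcup_n O n ->
  exists n (g : nat -> pform U X), [/\ forall i, fml_over A X (g i),
    forall i, clopen_of (g i) `<=` O i &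
    clopen_of (A := A) f `<=` \bigcup_(i < n) clopen_of (g i)].
Proof.
move=> fA Oo fO.
have fco : compact (clopen_of (A := A) f).
  by apply: subclosed_compact stone_compact _ => //; exact: closed_clopen_of.
pose D := [set p : {classic nat * pform U X} | fml_over A X p.2 /\ clopen_of
  p.2 `<=` O p.1].
rewrite compact_cover in fco.
have [//|//|D' D'D fD'] := fco _ D (fun p => clopen_of p.2).
- by move=> p [pA _]; exact: open_clopen_of.
- move=> q /fO[n _ Onq]; have [g [gA gq gO]] := open_clopen_base (Oo n) Onq.
  by exists (n, g).
pose l := enum_fset D'.
have lD p : p \in l -> D p by move=> /D'D/set_mem.
pose g i := \big[@f_or L (ccat X (params U))/fnot ftrue]_(p <- l | p.1 == i)
  p.2.
have gP i := @clopen_bigor _ l (fun p => p.1 == i) snd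
  (fun p pl _ => proj1 (lD p pl)).
exists (\max_(p <- l) p.1).+1, g;
  split=> [i|i q /(gP i).2[p pl /andP[/eqP <- /asboolP]]|q].
- by have [] := gP i.
- by have [_ /(_ q)] := lD p pl.
- move=> /fD'[p pl qp]; exists p.1; first by rewrite /= ltnS leq_bigmax_seq.
  by apply/(gP _).2; exists p => //; rewrite eqxx; exact/asboolP.
Qed.

End stone_space.

(** * Regular extension of a Keisler measure *)

Section regular_extension.
Context {R : realType} {L : language} (U : structure L) (X : ctx L).
Variables (A : ssubset U) (nu : pform U X -> R).
Hypothesis nuK : keisler nu.
Local Open Scope ereal_scope.
Implicit Types (f g : pform U X) (O B : set (stone U X A)).

Definition open_measure O : \bar R :=
  ereal_sup [set (nu f)%:E | f in
    [set f | fml_over A X f /\ clopen_of f `<=` O]].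

(** Outer regularity holds by construction; regularity from inside comes from applying it to
    complements. *)
Definition stone_outer B : \bar R :=
  ereal_inf [set open_measure O | O in [set O | open O /\ B `<=` O]].

Lemma open_measure_ge f O : fml_over A X f -> clopen_of f `<=` O ->
  (nu f)%:E <= open_measure O.
Proof. by move=> fA fO; apply: ereal_sup_ubound; exists f. Qed.

Lemma open_measure_le O (r : \bar R) :
  (forall f, fml_over A X f -> clopen_of f `<=` O -> (nu f)%:E <= r) ->
  open_measure O <= r.
Proof. by move=> h; apply: ge_ereal_sup => _ [f [fA fO] <-]; exact: h. Qed.

Lemma le_open_measure O O' : O `<=` O' -> open_measure O <= open_measure O'.
Proof.
move=> OO'; apply: open_measure_le => f fA fO.
by apply: open_measure_ge => //; exact: subset_trans OO'.
Qed.

Lemma open_measure_clopen f : fml_over A X f ->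
  open_measure (clopen_of f) = (nu f)%:E.
Proof.
move=> fA; apply/eqP; rewrite eq_le open_measure_ge// andbT.
apply: open_measure_le => g gA /clopen_of_sub gf.
by rewrite lee_fin; apply: keisler_le => //; exact: gf.
Qed.

Lemma open_measure_ge0 O : 0 <= open_measure O.
Proof.
apply: le_trans (open_measure_ge (f := fnot ftrue) _ _).
- by rewrite lee_fin; exact: keisler_ge0.
- by move=> t u [].
- by rewrite clopen_of0.
Qed.

Lemma open_measure_le1 O : open_measure O <= 1.
Proof. by apply: open_measure_le => f _ _; rewrite lee_fin keisler_le1. Qed.

(** By compactness a clopen set inside the union is covered by finitely many clopen subsets of the
    [O i]; finite subadditivity of [nu] then comes from integrating a pointwise comparison of
    indicators. *)
Lemma open_measure_bigcup (O : nat -> set (stone U X A)) :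
  (forall n, open (O n)) ->
  open_measure (\bigcup_n O n) <= \sum_(n <oo) open_measure (O n).
Proof.
move=> Oo; apply: open_measure_le => f fA fO.
have [n [g [gA gO fg]]] := clopen_cover fA Oo fO.
apply: le_trans (nneseries_lim_ge n _); last first.
  by move=> i _ _; exact: open_measure_ge0.
rewrite big_mkord.
apply: (@le_trans _ _ (\sum_(i < n) (nu (g i))%:E)); last first.
  by apply: lee_sum => i _; exact: open_measure_ge.
rewrite sumEFin lee_fin.
apply: (simple_integral_le nuK (simple_integral_ind nu f)
  (simple_integral_sum nuK (fun i : 'I_n => simple_integral_ind nu (g i)))) =>
    e.
rewrite /ind; case: (asboolP (psat f e)) => fe; last exact: sumr_ge0.
have [i /= iN /clopen_of_tp gi] : (\bigcup_(i < n) clopen_of (g i)) (tp A e).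
  by apply: fg; apply/clopen_of_tp.
rewrite (bigD1 (Ordinal iN))//= asboolT; last exact: gi.
by rewrite lerDl sumr_ge0.
Qed.

Lemma stone_outer_open O : open O -> stone_outer O = open_measure O.
Proof.
move=> Oo; apply/eqP; rewrite eq_le; apply/andP; split.
  by apply: ereal_inf_lbound; exists O => //; split.
by apply: le_ereal_inf_tmp => _ [G [_ OG] <-]; exact: le_open_measure.
Qed.

Lemma stone_outer_ge0 B : 0 <= stone_outer B.
Proof.
by apply: le_ereal_inf_tmp => _ [G _ <-]; exact: open_measure_ge0.
Qed.

Lemma le_stone_outer : {homo stone_outer : B B' / B `<=` B' >-> B <= B'}.
Proof.
move=> B B' BB'; apply: le_ereal_inf_tmp => _ [G [Go B'G] <-].
by apply: ereal_inf_lbound; exists G => //; split=> //; exact: subset_trans B'G.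
Qed.

Lemma stone_outer_fin B : stone_outer B \is a fin_num.
Proof.
rewrite ge0_fin_numE ?stone_outer_ge0//.
apply: (@le_lt_trans _ _ (open_measure setT)).
  by apply: ereal_inf_lbound; exists setT => //; split=> //; exact: openT.
by apply: le_lt_trans (open_measure_le1 _) _; rewrite ltry.
Qed.

Lemma stone_outer_adherent B (eps : R) : (0 < eps)%R ->
  exists O, [/\ open O, B `<=` O & open_measure O <= stone_outer B + eps%:E].
Proof.
move=> eps0; have [_ [G [Go BG] <-] h] :=
  lb_ereal_inf_adherent eps0 (stone_outer_fin B).
by exists G; split=> //; exact: ltW.
Qed.

Lemma stone_outer0 : stone_outer set0 = 0.
Proof.
rewrite stone_outer_open; last exact: open0.
rewrite -clopen_of0 open_measure_clopen; last by move=> t u [].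
by rewrite keisler_unsat// => e; rewrite /psat/=; tauto.
Qed.

Lemma stone_outer_sigma_subadditive : sigma_subadditive stone_outer.
Proof.
move=> F; apply/lee_addgt0Pr => eps eps0.
(* The n-th open set has excess eps / 2^(n+1), so the total excess is at most eps. *)
have h n : exists O, [/\ open O, F n `<=` O &
    open_measure O <= stone_outer (F n) + (eps / (2 ^ n.+1)%:R)%:E].
  by apply: stone_outer_adherent; rewrite divr_gt0// ltr0n expn_gt0.
have [G GP] := choice h.
apply: le_trans (epsilon_trick xpredT _ (ltW eps0)); last first.
  by move=> n; exact: stone_outer_ge0.
apply: (@le_trans _ _ (\sum_(n <oo) open_measure (G n))); last first.
  apply: lee_nneseries => [n _ _|n _]; first exact: open_measure_ge0.
  by have [] := GP n.
apply: le_trans (open_measure_bigcup _); last by move=> n; have [] := GP n.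
apply: ereal_inf_lbound; exists (\bigcup_n G n) => //; split.
  by apply: bigcup_open => n _; have [] := GP n.
by apply: subset_bigcup => n _; have [] := GP n.
Qed.

Definition stone_outer_measure : {outer_measure set (stone U X A) -> \bar R} :=
  HB.pack stone_outer (isOuterMeasure.Build R (stone U X A) stone_outer
    stone_outer0 stone_outer_ge0 le_stone_outer stone_outer_sigma_subadditive).

(** It suffices to test against open [V]. A clopen [f] inside both [V] and [O], and a clopen [g]
    inside [V] off [f], are disjoint with union inside [V]; take suprema over [g] and [f]. *)
Lemma open_caratheodory O : open O -> stone_outer_measure.-caratheodory O.
Proof.
move=> Oo; apply: le_caratheodory_measurable => B.
apply: le_ereal_inf_tmp => _ [V [Vo BV] <-].
apply: (@le_trans _ _ (open_measure (V `&` O) + stone_outer (V `&` ~` O))).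
  apply: leeD; last by apply: le_stone_outer; exact: setSI.
  rewrite -stone_outer_open; last exact: openI.
  by apply: le_stone_outer; exact: setSI.
rewrite -leeBrDr ?stone_outer_fin//.
apply: open_measure_le => f fA fVO.
rewrite leeBrDr ?stone_outer_fin// addeC -leeBrDr//.
have cfo : open (V `&` ~` clopen_of (A := A) f).
  by apply: openI => //; rewrite -clopen_ofC//; exact: open_clopen_of.
(* [V] off [f] is open, which [V] off [O] need not be, so its outer measure is again a supremum over
   clopen sets. *)
apply: (@le_trans _ _ (open_measure (V `&` ~` clopen_of f))).
  rewrite -stone_outer_open//; apply: le_stone_outer; apply: setIS.
  by apply: subsetC; apply: subset_trans fVO _; exact: subIsetr.
apply: open_measure_le => g gA gV.
rewrite leeBrDr// -EFinD -(@keisler_disjoint _ _ _ _ _ nuK _ _ (f_or g f)).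
- apply: open_measure_ge.
    by apply: fml_over_fnot; apply: fml_over_fand; exact: fml_over_fnot.
  rewrite clopen_ofU// => q [/gV[]//|/fVO[]//].
- move=> e [ge fe]; have [_] := gV (tp A e) ((clopen_of_tp e gA).2 ge).
  by apply; apply/clopen_of_tp.
- by move=> e; exact: psat_f_or.
Qed.

Lemma borel_caratheodory (B : set (borel_stone U X A)) :
  measurable B -> stone_outer_measure.-caratheodory B.
Proof.
move: B; apply: smallest_sub; last by move=> O; exact: open_caratheodory.
split.
- exact: caratheodory_measurable_set0.
- by move=> B mB; rewrite setTD; exact: caratheodory_measurable_setC.
- by move=> F mF; exact: caratheodory_measurable_bigcup.
Qed.

Lemma stone_outer_sigma_additive :
  semi_sigma_additive (stone_outer : set (borel_stone U X A) -> \bar R).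
Proof.
move=> F mF tF mbF.
apply: (@caratheodory_measure_sigma_additive R (stone U X A)
  stone_outer_measure F) => // [n|]; exact: borel_caratheodory.
Qed.

Lemma stone_outer_clopen f : fml_over A X f ->
  stone_outer (clopen_of f) = (nu f)%:E.
Proof.
by move=> fA; rewrite stone_outer_open ?open_measure_clopen//;
  exact: open_clopen_of.
Qed.

Lemma stone_outerT : stone_outer setT = 1.
Proof.
rewrite -clopen_ofT stone_outer_clopen; first by rewrite keisler_valid.
by move=> t u [].
Qed.

(** The closed set is the complement of an open set that approximates the complement of [B] from
    outside. *)
Lemma regular_extension_exists :
  exists P : probability (borel_stone U X A) R, regular_extension nu P.
Proof.
pose mM := isMeasure.Build _ (borel_stone U X A) R stone_outer
  stone_outer0 stone_outer_ge0 stone_outer_sigma_additive.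
pose P0 : {measure set (borel_stone U X A) -> \bar R} := HB.pack stone_outer mM.
pose mP := Measure_isProbability.Build _ _ R P0 stone_outerT.
pose P : probability (borel_stone U X A) R := HB.pack stone_outer mM mP.
exists P; split; first exact: stone_outer_clopen.
move=> B eps mB eps0.
(* Adherence gives non-strict bounds; two excesses of eps / 3 stay strictly below eps. *)
have e20 : (0 < eps / 3)%R by rewrite divr_gt0.
have [G [Go BG hG]] := stone_outer_adherent B e20.
have [G' [G'o BG' hG']] := stone_outer_adherent (~` B) e20.
exists (~` G'), G; split=> //.
- exact: open_closedC.
- by rewrite -[B]setCK; exact: subsetC.
have mopen (V : set (stone U X A)) : open V ->
    measurable (V : set (borel_stone U X A)).
  by move=> Vo; exact: sub_sigma_algebra.
have PD (V C : set (borel_stone U X A)) : open (V : set (stone U X A)) ->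
    measurable C -> C `<=` V ->
    open_measure V <= P C + (eps / 3)%:E -> P (V `\` C) <= (eps / 3)%:E.
  move=> Vo mC CV h; rewrite measureD//; [|exact: mopen|].
    by rewrite (setIidr CV) leeBlDl ?fin_num_measure// -stone_outer_open in h *.
  by rewrite -ge0_fin_numE ?fin_num_measure//; exact: mopen.
have mG := mopen _ Go; have mG' := mopen _ G'o.
apply: (@le_lt_trans _ _ ((eps / 3)%:E + (eps / 3)%:E)); last first.
  by rewrite -EFinD lte_fin; lra.
apply: (@le_trans _ _ (P ((G `\` B) `|` (G' `\` ~` B)))).
  apply: le_measure.
  - apply/mem_set.
    by apply: (@measurableD _ (borel_stone U X A)) => //; exact: measurableC.
  - apply/mem_set.
    by apply: measurableU; apply: measurableD => //; exact: measurableC.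
  - move=> q [Gq /contrapT G'q].
    by have [Bq|nBq] := pselect (B q); [right; split=> // /(_ Bq)|left].
apply: (@le_trans _ _ (P (G `\` B) + P (G' `\` ~` B))).
  by apply: measureU2; apply: measurableD => //; exact: measurableC.
by apply: leeD; apply: PD => //; exact: measurableC.
Qed.

End regular_extension.

(** * Adding finitely many points to an infinite set *)

(** Hilbert's hotel: [x] goes to the start of a sequence embedded in [A], the sequence is shifted by
    one, and all else is fixed. *)
Lemma card_le_setU1 (T : Type) (A : set T) (x : T) :
  infinite_set A -> x |` A #<= A.
Proof.
elim/Ppointed: T => T in A x *; first by case: (no x).
move=> /infiniteP/pcard_leP[e].
have [Ax|Ax] := pselect (A x).
  by apply: subset_card_le => y [->|].
have eA n : A (e n) by exact: funS.
pose h y := if y == x then e 0%N else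
  if y \in range e then e ('pinv_(fun=> 0%N) setT e y).+1 else y.
have eK n : 'pinv_(fun=> 0%N) setT e (e n) = n.
  by apply: pinvKV => //; exact/mem_set.
have xe n : (e n == x) = false.
  by apply/eqP => ex; apply: Ax; rewrite -ex.
have he n : h (e n) = e n.+1.
  by rewrite /h xe mem_set ?eK//; exists n.
have einj m n : e m = e n -> m = n by move=> emn; rewrite -(eK m) emn eK.
have h_spec y : [\/ y = x /\ h y = e 0%N, exists n, y = e n /\ h y = e n.+1 |
    [/\ forall n, h y <> e n, y <> x & h y = y]].
  have [->|yx] := eqVneq y x; first by constructor 1; rewrite /h eqxx.
  have [[n _ <-]|ye] := pselect (range e y).
    by constructor 2; exists n; rewrite he.
  constructor 3; rewrite /h (negbTE yx) memNset//.
  by split=> // [n yen|]; [apply: ye; exists n|exact/eqP].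
have hinj : {in x |` A &, injective h}.
  move=> y z _ _ hyz.
  have := h_spec y; have := h_spec z; rewrite hyz.
  case=> [[-> hz]|[n [-> hz]]|[zn _ hz]] [[-> hy]|[m [-> hy]]|[yn _ hy]] //.
  - by move: hy; rewrite hz => /einj.
  - by have := yn 0%N.
  - by move: hy; rewrite hz => /einj.
  - by move: hy; rewrite hz => /einj [->].
  - by have := yn n.+1.
  - by have := zn 0%N.
  - by have := zn m.+1.
  - by rewrite -hy hz.
rewrite -(card_le_eql (inj_card_eq hinj)); apply: subset_card_le => _ [y + <-].
by have [[_ ->]|[n [_ ->]]|[_ yx ->]] := h_spec y => -[].
Qed.

Lemma card_le_setU_finite (T : Type) (A B : set T) :
  infinite_set A -> finite_set B -> A `|` B #<= A.
Proof.
move=> Ainf /finite_setP[n]; elim: n B => [|n ih] B.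
  by rewrite II0 card_eq0 => /eqP ->; rewrite setU0.
move=> /eq_cardSP[x Bx /ih]; apply: card_le_trans.
rewrite (_ : A `|` B = x |` (A `|` B `\ x)).
  apply: card_le_setU1; apply: sub_infinite_set Ainf; exact: subsetUl.
by rewrite setUCA setD1K.
Qed.

(** * Uniform approximation of integrals *)

Section Rintegral_approximation.
Context {R : realType} d (T : measurableType d) (P : probability T R).

Lemma bounded_measurable_integrable (F : T -> R) r : measurable_fun setT F ->
  (forall x, `|F x| <= r) -> P.-integrable setT (EFin \o F).
Proof.
move=> mF Fr; apply: measurable_bounded_integrable => //.
  by rewrite -ge0_fin_numE ?fin_num_measure.
by exists r; split; [exact: num_real|move=> s rs x _; exact: le_trans (ltW rs)].
Qed.

Lemma Rintegral_indic B : measurable B ->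
  \int[P]_x (\1_B x : R) = fine (P B).
Proof. by move=> mB; rewrite /Rintegral integral_indic// setIT. Qed.

Lemma average_indic_measurable n (B : 'I_n -> set T) :
  (forall i, measurable (B i)) ->
  measurable_fun setT (fun x => (\sum_(i < n) \1_(B i) x) / n%:R : R).
Proof.
move=> mB; apply: measurable_realfun.measurable_funM => //.
by apply: measurable_sum => i; exact: measurable_realfun.measurable_indic.
Qed.

Lemma sum_indic_integrable n (B : 'I_n -> set T) :
  (forall i, measurable (B i)) ->
  P.-integrable setT (EFin \o (fun x => \sum_(i < n) \1_(B i) x : R)).
Proof.
move=> mB.
apply: (@bounded_measurable_integrable _ n%:R).
  by apply: measurable_sum => i; exact: measurable_realfun.measurable_indic.
move=> x; rewrite ger0_norm ?sumr_ge0//.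
rewrite -[in leRHS](card_ord n) -sum1_card natr_sum ler_sum// => i _.
by rewrite indicE; case: (_ \in _).
Qed.

Lemma Rintegral_average_indic n (B : 'I_n -> set T) :
  (forall i, measurable (B i)) ->
  \int[P]_x ((\sum_(i < n) \1_(B i) x) / n%:R : R) =
  (\sum_(i < n) fine (P (B i))) / n%:R.
Proof.
move=> mB; rewrite RintegralZr//; last exact: sum_indic_integrable.
congr (_ * _); elim: n B mB => [|n ih] B mB.
  rewrite big_ord0 (@eq_Rintegral _ _ _ _ _ (fun=> 0)) ?Rintegral_cst ?mul0r//.
  by move=> x _; rewrite big_ord0.
rewrite big_ord_recl -ih// -Rintegral_indic// -RintegralD//.
- by apply: eq_Rintegral => x _; rewrite big_ord_recl.
- exact: integrable_indic.
- exact: sum_indic_integrable.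
Qed.

Lemma Rintegral_near (F G : T -> R) r eps : measurable_fun setT F ->
  measurable_fun setT G -> (forall x, `|G x| <= r) ->
  (forall x, `|F x - G x| <= eps) ->
  `|\int[P]_x F x - \int[P]_x G x| <= eps.
Proof.
move=> mF mG Gr FG.
have iG := bounded_measurable_integrable mG Gr.
have iF : P.-integrable setT (EFin \o F).
  apply: (@bounded_measurable_integrable _ (eps + r)) => // x.
  by rewrite -[F x](subrK (G x)) (le_trans (ler_normD _ _))// lerD.
have iB : P.-integrable setT (EFin \o (fun x => F x - G x)).
  apply: (@bounded_measurable_integrable _ eps) => //.
  exact: measurable_realfun.measurable_funB.
rewrite -RintegralB// (le_trans (le_normr_Rintegral _ _))//.
rewrite -[leRHS](_ : \int[P]_(x in setT) eps = _); last first.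
  rewrite Rintegral_cst// [X in fine X](_ : _ = 1%E) ?mulr1//.
  exact: probability_setT.
apply: le_Rintegral => //.
  exact: integrable_norm.
exact: finite_measure_integrable_cst.
Qed.

Lemma EFin_Rintegral (F : T -> R) r : measurable_fun setT F ->
  (forall x, `|F x| <= r) ->
  (\int[P]_x F x)%:E = (\int[P]_x (F x)%:E)%E.
Proof.
move=> mF Fr; rewrite /Rintegral fineK//; apply: integrable_fin_num => //.
exact: bounded_measurable_integrable Fr.
Qed.

(** [F] is a pointwise limit of measurable approximants with error 1/(n+1). *)
Lemma measurable_near (F : T -> R) :
  (forall eps, 0 < eps ->
    exists2 G : T -> R, measurable_fun setT G & forall x, `|F x - G x| <= eps)
      ->
  measurable_fun setT F.
Proof.
move=> FG; have h n : exists G : T -> R, measurable_fun setT G /\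
    forall x, `|F x - G x| <= n.+1%:R^-1.
  by have [|G mG FGn] := FG n.+1%:R^-1; [rewrite invr_gt0|exists G].
have [G GP] := choice h.
apply: (@measurable_realfun.measurable_fun_cvg _ _ _ _ G) => [n|x _];
  first by have [] := GP n.
apply/cvgrPdist_le => eps eps0.
have := @near_infty_natSinv_lt R (PosNum eps0); apply: filterS => n /= nlt.
by apply: le_trans (ltW nlt); have [] := GP n.
Qed.

End Rintegral_approximation.

(** * Morley products *)

(** If [M] is finite, so is the union, and the monster cardinal is uncountable; if [M] is infinite,
    its cardinality does not grow. Saturation thus applies over [M] with the parameters of one
    formula. *)
Lemma small_setU_finite (L : language) (K : Type) (U : structure L)
    (M F : ssubset U) : monster K U -> small K M -> finite_set (tot F) ->
  small K (fun t => M t `|` F t).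
Proof.
move=> [[Knat _ _ _] _ _] Msmall Ffin.
rewrite /small (_ : tot _ = tot M `|` tot F)//.
have [Mfin|Minf] := pselect (finite_set (tot M)).
  have MFfin : finite_set (tot M `|` tot F) by rewrite finite_setU.
  apply/negP => /card_le_trans/(_ (finite_set_countable MFfin)).
  exact/negP.
by apply: contra Msmall => /card_le_trans; apply; exact: card_le_setU_finite.
Qed.

Section morley_approximation.
Context {R : realType} {L : language} (K : Type) (U : structure L).
Hypothesis hU : monster K U.
Variable M : ssubset U.
Hypotheses (hM : elementary_substructure M) (hMsmall : small K M).
Context (X W : ctx L) (mu : pform U X -> R).
Hypotheses (Xfin : finctx X) (Wfin : finctx W).
Hypotheses (muK : keisler mu) (mufim : fim M mu).

Definition copy k (a : assign U (ccopies 'I_k X)) (i : 'I_k) : assign U X :=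
  fun v => a (i, v).

(** The Morley product of Av(a) with [nu], evaluated at [psi]. *)
Definition average_linst (nu : pform U W -> R) (psi : pform U (ccat X W)) k
    (a : assign U (ccopies 'I_k X)) : R :=
  (\sum_(i < k) nu (linst psi (copy a i))) / k%:R.

Lemma realizes_iff (Y : ctx L) (A : ssubset U) (q : stone U Y A) (c : assign U
  Y) f :
  realizes c q -> fml_over A Y f -> tset q f <-> psat f c.
Proof.
move=> cq fA; split=> [/cq//|fc].
by have [//|/cq] := stone_em q fA.
Qed.

Lemma average_pinst (psi : pform U (ccat X W)) k (a : assign U (ccopies 'I_k
  X)) c :
  average a (pinst psi c) =
  (\sum_(i < k) ind (linst psi (copy a i)) c) / k%:R :> R.
Proof.
congr (_ / _); apply: eq_bigr => i _; rewrite /ind.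
by congr (_%:R); congr nat_of_bool; apply: asbool_equiv_eq;
  rewrite psat_pinst psat_linst.
Qed.

Section fixed_formula.
Variable psi : pform U (ccat X W).
Let A : ssubset U := fun t => @M t `|` params_of psi t.

Let linst_over k (a : assign U (ccopies 'I_k X)) i : (forall v, M (a v)) ->
  fml_over A W (linst psi (copy a i)).
Proof.
move=> aM; apply: fml_over_linst; first by move=> t u; right.
by move=> v; left; exact: (aM (i, v)).
Qed.

(** Av(a)(psi(x, c)) as a function of the type of [c]. When [a] lies in [M], each summand is the
    indicator of a clopen set given by a formula over [A]. *)
Let step k (a : assign U (ccopies 'I_k X)) (q : borel_stone U W A) : R :=
  (\sum_(i < k) \1_(clopen_of (linst psi (copy a i)) : set (stone U W A)) q) /
    k%:R.

(** Saturation realizes [q], so [fiber] is not its default value. The realization it selects need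
    not be [c0], but the uniform bound covers all of them. *)
Let step_near k (a : assign U (ccopies 'I_k X)) eps (q : borel_stone U W A) :
  (forall v, M (a v)) -> approximates mu psi eps a ->
  `|fiber mu psi (q : stone U W A) - step a q| <= eps.
Proof.
move=> aM ap; have As : small K A.
  by apply: small_setU_finite => //; exact: finite_params.
have [_ /(_ W A Wfin As q) [c0 c0q] _] := hU.
rewrite /fiber; case: xgetP => [r _ [c cq ->]|/(_ (mu (pinst psi c0)))];
  last first.
  by case; exists c0.
rewrite distrC; apply: le_trans (ap c).
rewrite le_eqVlt average_pinst; apply/orP; left; apply/eqP.
congr `|_ / _ - _|; apply: eq_bigr => i _; rewrite /ind indicE; congr (_%:R).
congr nat_of_bool; apply/idP/asboolP => [/set_mem|] h.
  exact: ((realizes_iff cq (linst_over aM)).1 h).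
exact/mem_set/((realizes_iff cq (linst_over aM)).2 h).
Qed.

Let step_measurable k (a : assign U (ccopies 'I_k X)) : (forall v, M (a v)) ->
  measurable_fun setT (step a).
Proof.
move=> aM; apply: average_indic_measurable => i.
by apply: sub_sigma_algebra; apply: open_clopen_of; exact: linst_over.
Qed.

Let step_bound k (a : assign U (ccopies 'I_k X)) q : `|step a q| <= 1.
Proof.
rewrite /step ger0_norm ?divr_ge0 ?sumr_ge0//.
case: k a => [|k] a; first by rewrite invr0 mulr0.
rewrite ler_pdivrMr ?ltr0n// mul1r -[in leRHS](card_ord k.+1) -sum1_card
  natr_sum.
by apply: ler_sum => i _; rewrite indicE; case: (_ \in _).
Qed.

(** The integrand is within eps of a step function, whose integral is [average_linst] because the
    extending measure agrees with [nu] on clopen sets. The bound holds for whichever regular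
    extension [morley] selects. *)
Lemma morley_near (nu : pform U W -> R) eps k (a : assign U (ccopies 'I_k X)) :
  keisler nu -> (forall v, M (a v)) -> approximates mu psi eps a ->
  `|morley M mu nu psi - average_linst nu psi a| <= eps.
Proof.
move=> nuK aM ap; pose F (q : borel_stone U W A) := fiber mu psi (q : stone U W
  A).
(* Tuples in [M] with arbitrarily small error make the integrand a uniform limit of step
   functions. *)
have mF : measurable_fun setT F.
  apply: measurable_near => e e0.
  have [k' [a' [_ a'M ap']]] := fim_approximation hM psi Xfin Wfin muK mufim e0.
  by exists (step a'); [exact: step_measurable|move=> q; exact: step_near].
have FP (P : probability (borel_stone U W A) R) :
    (\int[P]_q F q)%:E = (\int[P]_q (F q)%:E)%E.
  apply: (@EFin_Rintegral _ _ _ _ _ (eps + 1)) => // q.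
  rewrite -[F q](subrK (step a q)) (le_trans (ler_normD _ _))//.
  by apply: lerD; [exact: step_near|exact: step_bound].
rewrite /morley -/A; case: xgetP => [r _ [P [Pnu _] rE]|].
  have -> : r = \int[P]_q F q by apply: EFin_inj; rewrite FP.
  have <- : \int[P]_q step a q = average_linst nu psi a.
    rewrite Rintegral_average_indic; last first.
      by move=> i; apply: sub_sigma_algebra; apply: open_clopen_of;
        exact: linst_over.
    by congr (_ / _); apply: eq_bigr => i _; rewrite Pnu//; exact: linst_over.
  apply: (@Rintegral_near _ _ _ _ _ _ 1) => [||q|q].
  - exact: mF.
  - exact: step_measurable.
  - exact: step_bound.
  - exact: step_near.
(* A regular extension exists, so [morley] does not take its default value. *)
have [P Pnu] := regular_extension_exists A nuK.
by move/(_ (\int[P]_q F q)); case; exists P => //; exact: FP.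
Qed.

End fixed_formula.

Lemma morley_approximation (psi : pform U (ccat X W)) eps : 0 < eps ->
  exists k (a : assign U (ccopies 'I_k X)),
    [/\ (0 < k)%N, forall v, M (a v), approximates mu psi eps a &
      forall nu, keisler nu ->
        `|morley M mu nu psi - average_linst nu psi a| <= eps].
Proof.
move=> eps0.
have [k [a [k0 aM ap]]] := fim_approximation hM psi Xfin Wfin muK mufim eps0.
by exists k, a; split=> // nu nuK; exact: morley_near.
Qed.

Lemma simple_integral_average (nu : pform U W -> R) (psi : pform U (ccat X W)) k
    (a : assign U (ccopies 'I_k X)) : keisler nu ->
  simple_integral nu (fun c => average a (pinst psi c)) (average_linst nu psi
    a).
Proof.
move=> nuK; rewrite /average_linst mulrC.
rewrite (_ : (fun c => _) =
    fun c => k%:R^-1 * \sum_(i < k) ind (linst psi (copy a i)) c).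
  apply: simple_integralZ; apply: simple_integral_sum => // i.
  exact: simple_integral_ind.
by apply: funext => c; rewrite average_pinst mulrC.
Qed.

Lemma eq_of_close (x y C : R) : 0 < C ->
  (forall eps, 0 < eps -> `|x - y| <= C * eps) -> x = y.
Proof.
move=> C0 h; apply/eqP; rewrite -subr_eq0 -normr_le0;
  apply/ler_addgt0Pr => e e0.
by have := h (e / C) (divr_gt0 e0 C0); rewrite mulrC divfK ?gt_eqF// add0r.
Qed.

(** Each axiom passes to the limit from the averages [average_linst]. *)
Lemma morley_keisler (nu : pform U W -> R) : keisler nu ->
  keisler (morley M mu nu : pform U (ccat X W) -> R).
Proof.
move=> nuK; split.
- move=> phi psi phipsi; apply: (@eq_of_close _ _ 2) => // eps eps0.
  have [k [a [k0 aM ap /(_ nu nuK) h1]]] := morley_approximation phi eps0.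
  (* [phi] and [psi] may have different parameters, so their integrals live on different type
     spaces; a common tuple [a] compares them. *)
  have ap' : approximates mu psi eps a.
    by apply: (@approximates_equiv _ _ _ _ _ _ _ phi psi id) ap => // x c;
      rewrite phipsi.
  have := morley_near nuK aM ap'.
  rewrite (_ : average_linst nu psi a = average_linst nu phi a).
    by rewrite !ler_distl in h1 *; move: h1 => /andP[? ?] /andP[? ?]; lra.
  congr (_ / _); apply: eq_bigr => i _; apply: (keisler_equiv nuK) => e.
  by rewrite !psat_linst phipsi.
- move=> phi; apply/ler_addgt0Pr => eps eps0.
  have [k [a [k0 aM ap /(_ nu nuK)]]] := morley_approximation phi eps0.
  have : 0 <= average_linst nu phi a.
    by rewrite divr_ge0// sumr_ge0// => i _; exact: keisler_ge0.
  by rewrite ler_distl => ? /andP[? ?]; lra.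
- apply: (@eq_of_close _ _ 1) => // eps eps0.
  have [k [a [k0 aM ap /(_ nu nuK)]]] := morley_approximation ftrue eps0.
  rewrite (_ : average_linst nu ftrue a = 1) ?mul1r//.
  rewrite /average_linst (eq_bigr (fun=> 1)).
    by rewrite sumr_const card_ord divff// pnatr_eq0 -lt0n.
  by move=> i _; apply: keisler_valid.
(* Of the 6 eps, three come from comparing averages pointwise, through additivity of [mu] on fibres,
   and three from replacing each Morley value by an average. *)
- move=> phi psi phipsi; apply: (@eq_of_close _ _ 6) => // eps eps0.
  have [k [a [k0 aM ap /(_ nu nuK) h1]]] := morley_approximation phi eps0.
  have [k' [a' [k0' aM' ap' /(_ nu nuK) h1']]] := morley_approximation psi eps0.
  have [l [b [l0 bM bp /(_ nu nuK) h2]]] :=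
    morley_approximation (f_or phi psi : pform U (ccat X W)) eps0.
  have muD c : mu (pinst (f_or phi psi : pform U (ccat X W)) c) =
      mu (pinst phi c) + mu (pinst psi c).
    apply: (keisler_disjoint muK) => e.
      by rewrite !psat_pinst; exact: phipsi.
    by rewrite !psat_pinst psat_f_or.
  have I1 := simple_integralD (simple_integral_average phi a nuK)
    (simple_integral_average psi a' nuK).
  have I2 := simple_integral_average (f_or phi psi : pform U (ccat X W)) b nuK.
  have J e := simple_integral_cst nuK e.
  have pw c : `|(average a (pinst phi c) + average a' (pinst psi c)) -
      average b (pinst (f_or phi psi : pform U (ccat X W)) c)| <= 3 * eps.
    move: (ap c) (ap' c) (bp c); rewrite muD !ler_distl.
    by move=> /andP[? ?] /andP[? ?] /andP[? ?]; apply/andP; split; lra.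
  have := simple_integral_le nuK I1 (simple_integralD I2 (J (3 * eps))).
  have := simple_integral_le nuK I2 (simple_integralD I1 (J (3 * eps))).
  move=> /(_ _)/wrap[c|]; first by have := pw c;
    rewrite ler_distl => /andP[? ?]; lra.
  move=> k1 /(_ _)/wrap[c|]; first by have := pw c;
    rewrite ler_distl => /andP[? ?]; lra.
  move=> k2; move: h1 h1' h2; rewrite !ler_distl.
  by move=> /andP[? ?] /andP[? ?] /andP[? ?]; apply/andP; split; lra.
Qed.

End morley_approximation.

(** * Morley powers *)

Lemma keisler_psubst (R : realType) (L : language) (U : structure L)
    (X Y : ctx L) (s : substitution X Y) (nu : pform U Y -> R) :
  keisler nu -> keisler (fun phi : pform U X => nu (psubst s phi)).
Proof.
move=> nuK; split.
- move=> phi psi phipsi; apply: (keisler_equiv nuK) => e.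
  by rewrite !psat_psubst phipsi.
- by move=> phi; exact: keisler_ge0.
- exact: keisler_valid.
- move=> phi psi phipsi; apply: (keisler_disjoint nuK) => e.
    by rewrite !psat_psubst; exact: phipsi.
  by rewrite psat_psubst psat_f_or !psat_psubst.
Qed.

Section copies.
Context {L : language} (U : structure L) (X : ctx L).
Implicit Types (E : assign U (ccopies nat X)) (x : assign U X).

(** Truth in finitely many copies is phrased through infinite sequences [E], so that powers of
    different lengths are compared without casts between ordinals. *)
Definition restrict_copies m E : assign U (ccopies 'I_m X) :=
  fun v => E (val v.1, v.2).
Arguments restrict_copies : clear implicits.

Definition reindex_copies (g : nat -> nat) E : assign U (ccopies nat X) :=
  fun v => E (g v.1, v.2).

(** Every entry from [m] on becomes [x]; only entry [m] matters after restriction to [m.+1]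
    copies. *)
Definition update_copies m x E : assign U (ccopies nat X) :=
  fun v => if (v.1 < m)%N then E v else x v.2.

Definition extend_copies m (w : assign U (ccopies 'I_m X)) :
    assign U (ccopies nat X) :=
  fun v => if insub v.1 is Some i then w (i, v.2) else @some_val L U X v.2.

Lemma assign0_eq (e e' : assign U (ccopies 'I_0 X)) : e = e'.
Proof. by apply: assign_ext => -[[]]. Qed.

Lemma extend_copiesK m (w : assign U (ccopies 'I_m X)) :
  restrict_copies m (extend_copies w) = w.
Proof.
by apply: assign_ext => -[i v]; rewrite /restrict_copies /extend_copies/= valK.
Qed.

Lemma split_last_restrict m (psi : pform U (ccopies 'I_m.+1 X)) x E :
  psat (psubst (@split_last L m X) psi) (vcat x (restrict_copies m E)) <->
  psat psi (restrict_copies m.+1 (update_copies m x E)).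
Proof.
rewrite psat_psubst (_ : (fun v => _) = restrict_copies m.+1 (update_copies m x
  E))//.
apply: assign_ext => -[i v]; rewrite /split_last/= /restrict_copies
  /update_copies/=.
case: unliftP => [j ->|->] /=; last by rewrite ltnn.
have -> : bump m j = j by rewrite /bump leqNgt ltn_ord.
by rewrite ltn_ord.
Qed.

End copies.
Arguments restrict_copies {L U X} m E v.

Section morley_powers.
Context {R : realType} {L : language} (K : Type) (U : structure L).
Hypothesis hU : monster K U.
Variable M : ssubset U.
Hypotheses (hM : elementary_substructure M) (hMsmall : small K M).
Context (X : ctx L) (mu : pform U X -> R).
Hypotheses (Xfin : finctx X) (muK : keisler mu) (mufim : fim M mu).

Lemma morley_power_keisler n :
  keisler (@morley_power R L U M X mu n).
Proof.
elim: n => [|n ih]; last first.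
  apply: keisler_psubst; apply: (morley_keisler hU) => //.
  exact: finctx_ccopies.
(* There is only one assignment to no variables, so the 0-th power is a point mass. *)
pose e0 := @some_val L U (ccopies 'I_0 X).
have powE phi : @morley_power R L U M X mu 0 phi = `[< psat phi e0 >]%:R.
  congr (_%:R); congr nat_of_bool; apply: asbool_equiv_eq; split=> [//|h e].
  by rewrite (assign0_eq e e0).
split=> [phi psi phipsi|phi||phi psi phipsi]; rewrite !powE//.
- by congr (_%:R); congr nat_of_bool; apply: asbool_equiv_eq.
- by rewrite asboolT.
- rewrite -natrD (asbool_equiv_eq (psat_f_or phi psi e0)) asbool_or.
  have := phipsi e0.
  by case: (asboolP (psat phi e0)) => ?;
    case: (asboolP (psat psi e0)) => // ? [].
Qed.

(** Induction on [m]. If [g] hits the top variable, that variable is the [mu] factor in both powers,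
    and a common tuple [a] reduces the claim to fibres. Otherwise [psi'] does not depend on the top
    variable, and each of its fibres has the measure of [psi]. *)
Lemma morley_power_subsequence m n (psi' : pform U (ccopies 'I_m X))
    (psi : pform U (ccopies 'I_n X)) (g : nat -> nat) :
  {homo g : i j / (i < j)%N} -> (forall i, (i < n)%N -> (g i < m)%N) ->
  (forall E, psat psi' (restrict_copies m E) <->
     psat psi (restrict_copies n (reindex_copies g E))) ->
  morley_power M mu psi' = morley_power M mu psi.
Proof.
move=> gincr; elim: m n psi' psi => [|m ih] n psi' psi gnm psiE.
  case: n => [|n] in psi gnm psiE *; last by have := gnm 0%N isT.
  rewrite /=; congr (_%:R); congr nat_of_bool; apply: asbool_equiv_eq.
  pose E0 := @some_val L U (ccopies nat X).
  split=> h e.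
    rewrite (assign0_eq e (restrict_copies 0 (reindex_copies g E0))).
    by apply/psiE; exact: h.
  by rewrite (assign0_eq e (restrict_copies 0 E0)); apply/psiE; exact: h.
pose chi' := psubst (@split_last L m X) psi'.
(* Since [g] is increasing, only its last index can reach the top variable. *)
have [[n' nE gn']|gm] : (exists2 n', n = n'.+1 & g n' = m) \/
    (forall i, (i < n)%N -> (g i < m)%N).
  case: n gnm {psi psiE} => [|n] gnm; first by right.
  have [gn|gn] := eqVneq (g n) m; [by left; exists n|right=> i].
  have gnm' : (g n < m)%N by rewrite ltn_neqAle gn -ltnS gnm.
  rewrite ltnS leq_eqVlt => /orP[/eqP -> //|/gincr /ltn_trans]; exact.
- subst n; pose chi := psubst (@split_last L n' X) psi.
  have chiE x E : psat chi' (vcat x (restrict_copies m E)) <->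
      psat chi (vcat x (restrict_copies n' (reindex_copies g E))).
    rewrite !split_last_restrict psiE.
    rewrite (_ : restrict_copies n'.+1 _ =
      restrict_copies n'.+1 (update_copies n' x (reindex_copies g E)))//.
    apply: assign_ext => -[i v].
    rewrite /restrict_copies/reindex_copies/update_copies/=.
    have := ltn_ord i; rewrite ltnS leq_eqVlt => /orP[/eqP ->|lti].
      by rewrite gn' !ltnn.
    by rewrite lti -gn' gincr.
  apply: (@eq_of_close _ _ _ 2) => // eps eps0.
  have [k [a [k0 aM ap /(_ _ (morley_power_keisler n')) h]]] :=
    morley_approximation hU hM hMsmall Xfin (finctx_ccopies n' Xfin) muK mufim
      chi eps0.
  (* The fibres of [chi'] are fibres of [chi] along [g], so [a] serves both; each use costs eps. *)
  have ap' : approximates mu chi' eps a.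
    apply: (@approximates_equiv _ _ _ _ _ _ _ chi chi'
      (fun w => restrict_copies n' (reindex_copies g (extend_copies w)))) ap =>
        //.
    by move=> x c; rewrite -chiE extend_copiesK.
  have := morley_near hU hM hMsmall Xfin (finctx_ccopies m Xfin) muK mufim
    (morley_power_keisler m) aM ap'.
  rewrite (_ : average_linst _ chi' a =
      average_linst (@morley_power R L U M X mu n') chi a); last first.
    congr (_ / _); apply: eq_bigr => i _; apply: ih => [j jn'|E].
      by rewrite -gn'; exact: gincr.
    by rewrite !psat_linst chiE.
  move: h; rewrite /= !ler_distl => /andP[? ?] /andP[? ?].
  by apply/andP; split; lra.
- have chiE x E : psat chi' (vcat x (restrict_copies m E)) <->
      psat psi (restrict_copies n (reindex_copies g E)).
    rewrite split_last_restrict psiE.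
    rewrite (_ : restrict_copies n _ = restrict_copies n (reindex_copies g
      E))//.
    apply: assign_ext => -[i v].
    by rewrite /restrict_copies/reindex_copies/update_copies/= gm.
  apply: (@eq_of_close _ _ _ 1) => // eps eps0; rewrite mul1r.
  have [k [a [k0 aM ap /(_ _ (morley_power_keisler m)) /=]]] :=
    morley_approximation hU hM hMsmall Xfin (finctx_ccopies m Xfin) muK mufim
      chi' eps0.
  rewrite (_ : average_linst _ chi' a = morley_power M mu psi)//.
  rewrite /average_linst (eq_bigr (fun=> morley_power M mu psi)).
    by rewrite sumr_const card_ord -[_ *+ k]mulr_natr mulfK// pnatr_eq0 -lt0n.
  by move=> i _; apply: ih => // E; rewrite psat_linst chiE.
Qed.

Definition subsequence n (g : nat -> nat) :
    substitution (ccopies 'I_n X) (ccopies nat X) :=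
  fun v => @tvar L (ccopies nat X) (g v.1, v.2).

(** The sequence of variables is indiscernible for the infinite power, in the sense that only their
    order matters. [g n] copies suffice to express the formula, because [g] is increasing. *)
Lemma morley_omega_subsequence n (theta : pform U (ccopies 'I_n X))
    (g : nat -> nat) : {homo g : i j / (i < j)%N} ->
  morley_omega M mu (psubst (@subsequence n g) theta) = morley_power M mu theta.
Proof.
move=> gincr.
have psiex m : (g n <= m)%N -> exists2 psi : pform U (ccopies 'I_m X),
    (forall E, psat psi (restrict_copies m E) <->
       psat theta (restrict_copies n (reindex_copies g E))) &
    morley_power M mu psi = morley_power M mu theta.
  move=> gnm; have gm i : (i < n)%N -> (g i < m)%N.
    by move=> /gincr /leq_trans; exact.
  pose s : substitution (ccopies 'I_n X) (ccopies 'I_m X) := fun v =>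
    @tvar L (ccopies 'I_m X) (Ordinal (gm v.1 (ltn_ord v.1)), v.2).
  have sE E : psat (psubst s theta) (restrict_copies m E) <->
       psat theta (restrict_copies n (reindex_copies g E)).
    by rewrite psat_psubst.
  by exists (psubst s theta) => //; exact: (morley_power_subsequence gincr).
have thetaE E : psat (psubst (@subsequence n g) theta) E <->
    psat theta (restrict_copies n (reindex_copies g E)).
  by rewrite psat_psubst.
have widenE m (psi : pform U (ccopies 'I_m X)) E :
    psat (psubst (@widen_copies L m X) psi) E <-> psat psi (restrict_copies m
      E).
  by rewrite psat_psubst.
rewrite /morley_omega; case: xgetP => [r _ [m [psi [psiE ->]]]|].
  (* The presentation selected by [morley_omega] may use any number [m] of copies; both
     presentations are compared in a common larger number. *)
  have [psi' psi'E <-] := psiex (maxn m (g n)) (leq_maxr _ _).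
  apply/esym; apply: (@morley_power_subsequence _ _ _ _ id) => // [i im|E].
    by rewrite leq_max im.
  by rewrite psi'E -thetaE -psiE widenE.
have [psi psiE psith] := psiex _ (leqnn _).
move/(_ (morley_power M mu theta)); case; exists (g n), psi; split=> // E.
by rewrite widenE psiE thetaE.
Qed.

End morley_powers.

(** * The limit *)

Lemma sorted_seq_of_card (B : set nat) k : ~~ (B #<= `I_k) ->
  exists s : seq nat,
    [/\ sorted ltn s, (k < size s)%N & forall i, i \in s -> B i].
Proof.
move=> Bk.
have [D DB kD] : exists2 D : {fset nat}, [set` D] `<=` B & (k < #|` D|)%N.
  have [Bfin|] := pselect (finite_set B); last exact: infinite_set_fset.
  exists (fset_set B); first by rewrite fset_setK.
  rewrite ltnNge; apply: contra Bk => Dk.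
  have /finite_setP[n Bn] := Bfin.
  rewrite (card_le_eql Bn) card_le_II; apply: leq_trans Dk.
  by rewrite (card_fset_set Bn).
exists (sort leq D); split.
- by rewrite ltn_sorted_uniq_leq sort_uniq fset_uniq sort_sorted//;
  exact: leq_total.
- by rewrite size_sort.
- by move=> i; rewrite mem_sort => iD; exact: DB.
Qed.

Lemma increasing_extension (s : seq nat) : sorted ltn s ->
  exists2 g : nat -> nat, {homo g : i j / (i < j)%N} &
    forall i, (i < size s)%N -> g i \in s.
Proof.
move=> ss.
(* Past the end of the list the values continue above its maximum. *)
pose g i := if (i < size s)%N then nth 0%N s i else ((\max_(x <- s) x) + i).+1.
exists g => [i j ij|i is_]; last by rewrite /g is_ mem_nth.
rewrite /g; case: (ltnP j (size s)) => js.
  have is_ := ltn_trans ij js; rewrite is_.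
  by apply: (sorted_ltn_nth ltn_trans) => //; rewrite inE.
case: ifP => is_; last by rewrite ltnS ltn_add2l.
rewrite ltnS (leq_trans _ (leq_addr _ _))//.
exact: (leq_bigmax_seq _ (mem_nth 0%N is_)).
Qed.

Section main_estimate.
Context {R : realType} {L : language} (K : Type) (U : structure L).
Hypothesis hU : monster K U.
Variable M : ssubset U.
Hypotheses (hM : elementary_substructure M) (hMsmall : small K M).
Context (X Y : ctx L) (mu : pform U X -> R).
Hypotheses (Xfin : finctx X) (Yfin : finctx Y).
Hypotheses (muK : keisler mu) (mufim : fim M mu).

Lemma ind_psubst (V W : ctx L) (s : substitution V W) (f : pform U V) e :
  ind (psubst s f) e = ind f (fun v => teval e (s v)) :> R.
Proof.
by congr (_%:R); congr nat_of_bool; apply: asbool_equiv_eq; exact: psat_psubst.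
Qed.

(** Under [lambda], compare the average along the variables x_(g i) with the average along a tuple
    [a] from [M]. They differ by 3 eps in integral: 2 eps pointwise where [theta] holds, and eps for
    the measure of its negation. The fourth eps relates [a] to the Morley product. *)
Lemma average_copies_near (psi : pform U (ccat X Y)) (eps : R) k
    (theta : pform U (ccopies 'I_k X)) (nu : pform U Y -> R)
    (lambda : pform U (ccat (ccopies nat X) Y) -> R) (g : nat -> nat) :
  0 < eps -> fml_over M _ theta -> 1 - eps < morley_power M mu theta ->
  (forall a, psat theta a -> approximates mu psi eps a) ->
  keisler nu -> keisler lambda ->
  left_restrict_eq M lambda (morley_omega M mu) ->
  right_restrict_eq lambda nu ->
  {homo g : i j / (i < j)%N} ->
  `| (\sum_(i < k) lambda (psubst (at_copy X Y (g i)) psi)) / k%:R -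
     morley M mu nu psi | <= 4 * eps.
Proof.
move=> eps0 thetaM theta1 thetaP nuK lambdaK lambdaL lambdaR gincr.
have [l [a [l0 aM ap /(_ nu nuK) morley_a]]] :=
  morley_approximation hU hM hMsmall Xfin Yfin muK mufim psi eps0.
pose right_of (e : assign U (ccat (ccopies nat X) Y)) : assign U Y :=
  fun y => e (inr y).
pose left_of (e : assign U (ccat (ccopies nat X) Y)) : assign U (ccopies 'I_k
  X) :=
  fun v => e (inl (g v.1, v.2)).
have intF : simple_integral lambda
    (fun e => average (left_of e) (pinst psi (right_of e)))
    ((\sum_(i < k) lambda (psubst (at_copy X Y (g i)) psi)) / k%:R).
  rewrite mulrC (_ : (fun e => _) = fun e =>
      k%:R^-1 * \sum_(i < k) ind (psubst (at_copy X Y (g i)) psi) e).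
    apply: simple_integralZ; apply: simple_integral_sum => // i.
    exact: simple_integral_ind.
  apply: funext => e; rewrite average_pinst mulrC; congr (_ * _).
  apply: eq_bigr => i _; congr (_%:R); congr nat_of_bool.
  apply: asbool_equiv_eq; rewrite psat_linst psat_psubst.
  by rewrite (_ : vcat _ _ = fun v => teval e (at_copy X Y (g i) v))//;
    apply: assign_ext => -[].
(* The entries of [a] are constants, so only the restriction of [lambda] to [y] enters, which is
   [nu]. *)
have intG : simple_integral lambda
    (fun e => average a (pinst psi (right_of e))) (average_linst nu psi a).
  rewrite /average_linst mulrC.
  pose s : substitution Y (ccat (ccopies nat X) Y) :=
    fun y => @tvar L (ccat (ccopies nat X) Y) (inr y).
  rewrite (_ : (fun e => _) = fun e => l%:R^-1 *
      \sum_(i < l) ind (psubst s (linst psi (copy a i))) e).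
    apply: simple_integralZ; apply: simple_integral_sum => // i.
    by rewrite -lambdaR; exact: simple_integral_ind.
  apply: funext => e; rewrite average_pinst mulrC; congr (_ * _).
  by apply: eq_bigr => i _; rewrite ind_psubst.
pose theta_g := psubst (fun x => @tvar L (ccat (ccopies nat X) Y) (inl x))
  (psubst (@subsequence L X k g) theta).
have intH := simple_integral_ind lambda (fnot theta_g).
(* [theta_g] is over [M], so [lambda] gives it the value of the infinite power, which is that of
   [theta] by invariance along [g]. *)
have lambda_theta : lambda (fnot theta_g) <= eps.
  rewrite (keisler_not lambdaK) /theta_g lambdaL; last exact: fml_over_psubst.
  by rewrite (morley_omega_subsequence hU)//; lra.
(* Where [theta_g] fails both averages still lie in [0, 1]; where it holds each is within eps of the
   measure of the fibre. *)
have pw e : `|average (left_of e) (pinst psi (right_of e)) -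
    average a (pinst psi (right_of e))| <= ind (fnot theta_g) e + 2 * eps.
  rewrite /ind; case: asboolP => [_|/contrapT h].
    have := average_ge0 (R := R) (left_of e) (pinst psi (right_of e)).
    have := average_le1 (R := R) (left_of e) (pinst psi (right_of e)).
    have := average_ge0 (R := R) a (pinst psi (right_of e)).
    have := average_le1 (R := R) a (pinst psi (right_of e)).
    by rewrite ler_norml /= => ? ? ? ?; apply/andP; split; lra.
  have /thetaP/(_ (right_of e)) : psat theta (left_of e).
    by have : psat theta_g e := h; rewrite /theta_g !psat_psubst.
  move: (ap (right_of e)); rewrite !ler_distl /= => /andP[? ?] /andP[? ?].
  by apply/andP; split; lra.
have intE := simple_integralD intH (simple_integral_cst lambdaK (2 * eps)).
have k1 := simple_integral_le lambdaK intF (simple_integralD intG intE).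
have k2 := simple_integral_le lambdaK intG (simple_integralD intF intE).
move: morley_a; rewrite !ler_distl => /andP[? ?].
have {}k1 := k1 (fun e => ltac:(move: (pw e); rewrite ler_distl => /andP[? ?];
  lra)).
have {}k2 := k2 (fun e => ltac:(move: (pw e); rewrite ler_distl => /andP[? ?];
  lra)).
by apply/andP; split; lra.
Qed.

End main_estimate.

Theorem theorem3p9 (R : realType) (L : language) (T : theory L)
    (hT : complete_theory T)
    (K : Type) (U : structure L) (hU : monster K U) (hUT : models U T)
    (M : ssubset U) (hM : elementary_substructure M) (hMsmall : small K M)
    (X Y Z : ctx L) (hX : finctx X) (hY : finctx Y) (hZ : finctx Z)
    (mu : pform U X -> R) (hmu : keisler mu) (hfim : fim M mu)
    (phi : formula (ccat (ccat X Y) Z)) :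
  (forall (nu : pform U Y -> R) (b : assign U Z)
          (lambda : pform U (ccat (ccopies nat X) Y) -> R),
     keisler nu -> keisler lambda ->
     left_restrict_eq M lambda (morley_omega M mu) ->
     right_restrict_eq lambda nu ->
     (fun i => lambda (psubst (at_copy X Y i) (pinst (plift U phi) b))) @ \oo
       --> morley M mu nu (pinst (plift U phi) b))
  /\
  (forall eps : R, 0 < eps -> exists n : nat,
     forall (nu : pform U Y -> R) (b : assign U Z)
            (lambda : pform U (ccat (ccopies nat X) Y) -> R),
       keisler nu -> keisler lambda ->
       left_restrict_eq M lambda (morley_omega M mu) ->
       right_restrict_eq lambda nu ->
       [set i : nat |
          ~~ (`| lambda (psubst (at_copy X Y i) (pinst (plift U phi) b)) -
                 morley M mu nu (pinst (plift U phi) b) | <= eps)] #<= `I_n).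
Proof.
(* The uniform bound comes first; the limit follows from it. *)
have uniform eps : 0 < eps -> exists n : nat,
    forall (nu : pform U Y -> R) (b : assign U Z)
            (lambda : pform U (ccat (ccopies nat X) Y) -> R),
       keisler nu -> keisler lambda ->
       left_restrict_eq M lambda (morley_omega M mu) ->
       right_restrict_eq lambda nu ->
       [set i : nat |
          ~~ (`| lambda (psubst (at_copy X Y i) (pinst (plift U phi) b)) -
                 morley M mu nu (pinst (plift U phi) b) | <= eps)] #<= `I_n.
  move=> eps0; have eps40 : 0 < eps / 4 by rewrite divr_gt0.
  (* Grouping [z] with [y] makes the fim estimate uniform in [b], so [k] is chosen before [nu], [b]
     and [lambda]. *)
  pose s : substitution (ccat (ccat X Y) Z) (ccat X (ccat Y Z)) := fun v =>
    match v as v return lterm (ccat X (ccat Y Z)) (@srt _ (ccat (ccat X Y) Z)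
      v) with
    | inl (inl x) => @tvar L (ccat X (ccat Y Z)) (inl x)
    | inl (inr y) => @tvar L (ccat X (ccat Y Z)) (inr (inl y))
    | inr z => @tvar L (ccat X (ccat Y Z)) (inr (inr z))
    end.
  have [k [theta [k0 thetaM theta1 thetaP]]] :=
    fim_formula (fsubst s phi) hmu hfim (finctx_ccat hY hZ) eps40.
  (* Among more than 2k exceptional indices, at least k lie on one side of [r]. *)
  exists (k + k)%N => nu b lambda nuK lambdaK lambdaL lambdaR.
  set psi := pinst (plift U phi) b; set r := morley M mu nu psi.
  pose f i := lambda (psubst (at_copy X Y i) psi).
  have psiP a : psat theta a -> approximates mu psi (eps / 4) a.
    move=> /thetaP; apply: (@approximates_equiv _ _ _ _ _ _ _ _ _ (fun c =>
      vcat c b)) => //.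
    move=> x y; rewrite psat_pinst !psat_plift sat_fsubst.
    by rewrite (_ : (fun v => _) = vcat (vcat x y) b)//;
      apply: assign_ext => -[[]|].
  have avg (g : nat -> nat) : {homo g : i j / (i < j)%N} ->
      `|(\sum_(i < k) f (g i)) / k%:R - r| <= eps.
    move=> gincr; have := average_copies_near hU hM hMsmall hX hY hmu hfim eps40
      thetaM theta1 psiP nuK lambdaK lambdaL lambdaR gincr.
    by move=> /le_trans; apply; lra.
  have kR : 0 < k%:R :> R by rewrite ltr0n.
  (* k indices on the same side of r would move the average away from r. *)
  have few (t : seq nat) : sorted ltn t -> (k <= size t)%N ->
      ~ (forall i, i \in t -> eps < f i - r) /\
      ~ (forall i, i \in t -> eps < r - f i).
    move=> /increasing_extension[g gincr gt] kt; have := avg g gincr.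
    rewrite ler_distl ler_pdivlMr// ler_pdivrMr// => /andP[h1 h2].
    have cst (c : R) : c * k%:R = \sum_(i < k) c.
      by rewrite sumr_const card_ord mulr_natr.
    split=> ft.
      move: h2; rewrite cst leNgt => /negP; apply.
      apply: ltr_sum => [|i _]; first by apply/hasP; exists (Ordinal k0);
        rewrite ?mem_index_enum.
      by have := ft _ (gt i (leq_trans (ltn_ord i) kt)); lra.
    move: h1; rewrite cst leNgt => /negP; apply.
    apply: ltr_sum => [|i _]; first by apply/hasP; exists (Ordinal k0);
      rewrite ?mem_index_enum.
    by have := ft _ (gt i (leq_trans (ltn_ord i) kt)); lra.
  apply: contrapT => /negP/sorted_seq_of_card[t [ts kt tB]].
  pose up := [pred i | eps < f i - r].
  have sub (q : pred nat) : sorted ltn (seq.filter q t).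
    by apply: sorted_filter ts; exact: ltn_trans.
  have [ku|ku] := leqP k (size (seq.filter up t)).
    have [+ _] := few _ (sub up) ku; apply => i.
    by rewrite mem_filter => /andP[].
  have kd : (k <= size (seq.filter (predC up) t))%N.
    have := count_predC up t; rewrite !size_filter in ku *.
    by move: kt; lia.
  have [_] := few _ (sub (predC up)) kd; apply => i.
  rewrite mem_filter => /andP[/= + /tB /= ].
  by rewrite -leNgt -ltNge -/(f i) ltr_normr => ? /orP[|]; lra.
split=> // nu b lambda nuK lambdaK lambdaL lambdaR.
apply/cvgrPdist_le => eps eps0.
have [n /(_ nu b lambda nuK lambdaK lambdaL lambdaR) bad] := uniform eps eps0.
(* The exceptional set is finite, and every index past its maximum is good. *)
have [D DE] := finite_fsetP.1 (card_le_finite bad (finite_II n)).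
exists (\max_(i <- D) i).+1 => // i /= Di; rewrite distrC.
apply: contrapT => /negP ibad.
have iD : i \in D by have : [set` D] i by rewrite -DE.
by move: Di; rewrite ltnNge (leq_bigmax_seq _ iD).
Qed.
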